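(* Let $X$ be an infinite-dimensional complex quasi-Banach space. If $X$ is hereditarily indecomposable (HI) then every bounded linear operator $T:X\to X$ is of the form $T=\lambda I+S$ where $\lambda\in\mathbb C$ and $S:X\to X$ is strictly singular.
   Context: A quasi-Banach space is a complete quasi-normed space; its quasi-norm is assumed $p$-subadditive for a suitable $0<p\le1$: $\|x+y\|^p\le\|x\|^p+\|y\|^p$. $X$ is hereditarily indecomposable (HI) if there are no two infinite-dimensional closed subspaces $V,W$ of $X$ with $V\cap W=\{0\}$ and $V+W$ closed. A bounded linear operator $T:X\to Y$ is an isomorphic embedding if there is $c>0$ with $\|Tx\|\ge c\|x\|$ for all $x\in X$; $T$ is strictly singular if $T|_V$ fails to be an isomorphic embedding for every infinite-dimensional subspace $V$ of $X$. *)

(* Defs.v *)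
From HB Require Import structures.
From mathcomp Require Import all_boot all_order all_algebra.
From mathcomp Require Export complex.
From mathcomp Require Import all_classical all_reals all_analysis.

Set Implicit Arguments.
Unset Strict Implicit.
Unset Printing Implicit Defensive.

Import Order.TTheory GRing.Theory Num.Theory.

Local Open Scope classical_set_scope.
Local Open Scope ring_scope.

(* The quasi-norm takes values in R, hence the modulus [Normc.normc] rather    *)
(* than the R[i]-valued norm of [numClosedFieldType].  As in                   *)
(* [pseudometric_normed_Zmodule], the uniform structure (hence [closed] and    *)
(* completeness) is required to be the one induced by the quasi-norm.  It is   *)
(* stated on entourages because the balls of a quasi-norm do not satisfy the   *)
(* triangle axiom of [PseudoMetric].                                           *)
HB.mixin Record PreUniformLmodule_isQuasiNormed (R : realType) X
    & PreUniformLmodule R[i] X := {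
  qnorm : X -> R ;
  qnorm_ge0 : forall x, 0 <= qnorm x ;
  qnorm0_eq0 : forall x, qnorm x = 0 -> x = 0 ;
  qnormZ : forall (a : R[i]) x, qnorm (a *: x) = Normc.normc a * qnorm x ;
  qnorm_quasi_triangle : exists K : R, 1 <= K /\
    forall x y, qnorm (x + y) <= K * (qnorm x + qnorm y) ;
  qnorm_entourageE : entourage =
    entourage_ (fun (x : X) (e : R) => [set y | qnorm (x - y) < e]) ;
}.

#[short(type="quasiNormedType")]
HB.structure Definition QuasiNormed (R : realType) :=
  {X of PreUniformLmodule R[i] X & PreUniformLmodule_isQuasiNormed R X}.

(* [Uniform_isComplete], with [cvg F] in the unfolded form [exists l, F --> l]  *)
(* because an lmodule has no canonical [Pointed] structure.                    *)
HB.mixin Record QuasiNormed_isComplete (R : realType) X & QuasiNormed R X := {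
  qcauchy_cvg : forall F : set_system X,
    ProperFilter F -> cauchy F -> exists l : X, F --> l ;
}.

#[short(type="quasiBanachType")]
HB.structure Definition QuasiBanach (R : realType) :=
  {X of QuasiNormed R X & QuasiNormed_isComplete R X}.

Definition p_subadditive (R : realType) (X : quasiNormedType R) (p : R) : Prop :=
  forall x y : X, qnorm (x + y) `^ p <= qnorm x `^ p + qnorm y `^ p.

Section QuasiBanachSpaces.
Context {R : realType}.
Implicit Types X Y : quasiNormedType R.

Definition is_subspace X (V : set X) : Prop :=
  V 0 /\ forall (a : R[i]) (x y : X), V x -> V y -> V (a *: x + y).

Definition finite_dim X (V : set X) : Prop :=
  exists (n : nat) (b : 'I_n -> X), (forall i, V (b i)) /\
    forall x, V x -> exists c : 'I_n -> R[i], x = \sum_(i < n) c i *: b i.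

Definition infinite_dim_subspace X (V : set X) : Prop :=
  is_subspace V /\ ~ finite_dim V.

Definition hereditarily_indecomposable X : Prop :=
  ~ exists V W : set X,
    [/\ infinite_dim_subspace V /\ closed V,
        infinite_dim_subspace W /\ closed W,
        V `&` W = [set 0] &
        closed [set v + w | v in V & w in W]].

Definition bounded_operator X Y (T : X -> Y) : Prop :=
  exists M : R, forall x, qnorm (T x) <= M * qnorm x.

(* T restricted to V is an isomorphic embedding. *)
Definition isomorphic_embedding_on X Y (V : set X) (T : X -> Y) : Prop :=
  exists c : R, 0 < c /\ forall x, V x -> c * qnorm x <= qnorm (T x).

Definition strictly_singular X Y (T : X -> Y) : Prop :=
  forall V : set X, infinite_dim_subspace V -> ~ isomorphic_embedding_on V T.

End QuasiBanachSpaces.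

Arguments hereditarily_indecomposable {R} X.

(* Main.v *)
Require Import Defs.
From HB Require Import structures.
From mathcomp Require Import all_boot all_order all_algebra.
From mathcomp Require Import complex ring lra.
From mathcomp Require Import all_classical all_reals all_analysis.

(** Suppose that no translate [T - l] is strictly singular, so that each of them
    is an embedding on some infinite-dimensional subspace.  A contradiction is
    reached in three steps, none of which uses convexity, linear functionals,
    finite-codimensional subspaces or basic sequences; in a quasi-Banach space
    none of these need be available.

    Hereditary indecomposability prevents an operator that is an embedding on
    one infinite-dimensional subspace from being small on another
    ([embedding_not_small]).

    An operator [S] that is small on no infinite-dimensional subspace is bounded
    below modulo a finite-dimensional kernel ([bounded_below_of_not_small]).  If
    not, infinitely many vectors spanning a subspace on which [S] is small are
    chosen one after the other.  The choice is controlled by the p-seminorms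
    [gauge k], the largest ones below both the quasi-norm and [k] times the
    seminorm of [S x].  When these are all dominated by the seminorm of [S x],
    the iteration of the open mapping theorem applies; when they are not, there
    is a vector on which [S] is small relative to a gauge, and the gauges, being
    continuous for the topology of [S], keep the estimates already obtained.

    Consequently every [T - l] is bounded below for the measure of
    noncompactness of bounded families ([noncompactness_below]).  Evaluating
    polynomials in [T] on the unit ball, whose noncompactness is positive, gives
    a p-seminorm [f] on [C[X]] for which multiplication by [X] is bounded and
    multiplication by each [X - l] is bounded below.  By a Gelfand-Mazur
    argument such an [f] vanishes ([shifts_below_eq0]): the spectral radius of
    the formal inverse of [X - l] is a function of [l] whose reciprocal is
    continuous and tends to infinity, so it has a maximum; a maximum spreads to
    a disc of fixed radius, hence along a whole ray, which contradicts the decay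
    at infinity.  The usual mean over roots of unity would cost a power of their
    number for a p-seminorm, and is replaced by the factorization of
    [Y ^ n - s ^ n]. *)

Set Implicit Arguments.
Unset Strict Implicit.
Unset Printing Implicit Defensive.

Import Order.TTheory GRing.Theory Num.Theory.
Import numFieldNormedType.Exports.
Local Open Scope classical_set_scope.
Local Open Scope ring_scope.

(** * The p-th power of the modulus *)

Section Modulus.
Context {R : realType} (p : R).
Hypothesis p_gt0 : 0 < p.
Implicit Types a b : R[i].

Definition cmodp a : R := Normc.normc a `^ p.

Lemma normc_ge0 a : 0 <= Normc.normc a.
Proof. by case: a => x y; exact: sqrtr_ge0. Qed.

Lemma normc_eq0 a : (Normc.normc a == 0) = (a == 0).
Proof.
apply/eqP/eqP => [/Normc.eq0_normc //|->]; exact: Normc.normc0.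
Qed.

Lemma cmodp_ge0 a : 0 <= cmodp a.
Proof. exact: powR_ge0. Qed.

Lemma cmodp0 : cmodp 0 = 0.
Proof. by rewrite /cmodp Normc.normc0 powR0 // gt_eqF. Qed.

Lemma cmodp1 : cmodp 1 = 1.
Proof. by rewrite /cmodp Normc.normc1 powR1. Qed.

Lemma cmodp_gt0 a : a != 0 -> 0 < cmodp a.
Proof. by move=> a0; rewrite powR_gt0// lt_neqAle normc_ge0 eq_sym normc_eq0 a0. Qed.

Lemma cmodpM a b : cmodp (a * b) = cmodp a * cmodp b.
Proof. by rewrite /cmodp Normc.normcM powRM// normc_ge0. Qed.

Lemma cmodpX a n : cmodp (a ^+ n) = cmodp a ^+ n.
Proof. by elim: n => [|n IH]; rewrite ?cmodp1// !exprS cmodpM IH. Qed.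

Lemma cmodpN a : cmodp (- a) = cmodp a.
Proof. by rewrite /cmodp (@normcN R). Qed.

Lemma cmodpV a : cmodp a^-1 = (cmodp a)^-1.
Proof.
have [->|a0] := eqVneq a 0; first by rewrite invr0 cmodp0 invr0.
have h := cmodp_gt0 a0.
by apply: (mulfI (lt0r_neq0 h)); rewrite -cmodpM !divff ?cmodp1// gt_eqF.
Qed.

Lemma cmodp_real (r : R) : 0 <= r -> cmodp (r%:C)%C = r `^ p.
Proof. by move=> r0; rewrite /cmodp /= expr0n /= addr0 sqrtr_sqr ger0_norm. Qed.

Lemma cmodp_surj (r : R) : 0 <= r -> exists2 s : R, 0 <= s & cmodp (s%:C)%C = r.
Proof.
move=> r0; exists (r `^ p^-1); first exact: powR_ge0.
rewrite cmodp_real ?powR_ge0// -powRrM mulVf ?gt_eqF// powRr1//.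
Qed.

Lemma cmodp_lt a (e : R) : 0 < e -> Normc.normc a < e `^ p^-1 -> cmodp a < e.
Proof.
move=> e0 ae; rewrite -[ltRHS]powRr1 ?(ltW e0)// -(mulVf (lt0r_neq0 p_gt0)) powRrM.
by rewrite gt0_ltr_powR// ?nnegrE ?powR_ge0 ?normc_ge0.
Qed.

Lemma cmodp_gt a (e : R) : 0 <= e -> e `^ p^-1 < Normc.normc a -> e < cmodp a.
Proof.
move=> e0 ae; rewrite -[ltLHS]powRr1// -(mulVf (lt0r_neq0 p_gt0)) powRrM.
by rewrite gt0_ltr_powR// ?nnegrE ?powR_ge0 ?normc_ge0.
Qed.

(** Both the real and the imaginary axes are controlled by the modulus; this
    turns statements about discs into statements about squares. *)
Lemma normc_le_abs (x y : R) : Normc.normc (x +i* y)%C <= `|x| + `|y|.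
Proof.
rewrite /= -[leRHS]ger0_norm ?addr_ge0// -sqrtr_sqr ler_wsqrtr//.
rewrite sqrrD !real_normK ?num_real// lerD2r lerDl.
by rewrite mulrn_wge0// mulr_ge0.
Qed.

Lemma abs_le_normc (x y : R) :
  `|x| <= Normc.normc (x +i* y)%C /\ `|y| <= Normc.normc (x +i* y)%C.
Proof. by rewrite /= -!sqrtr_sqr; split; rewrite ler_wsqrtr// ?lerDl ?lerDr sqr_ge0. Qed.

(** A continuous function on the plane that tends to infinity attains its
    minimum.  It is used for the distance from a finite-dimensional space and
    for the reciprocal of the growth rate of a resolvent. *)
Lemma coercive_min (phi : R[i] -> R) :
  (forall e, 0 < e -> exists2 d, 0 < d &
     forall a b, Normc.normc (a - b) < d -> `|phi a - phi b| < e) ->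
  (forall K : R, exists r, forall a, r < Normc.normc a -> K <= phi a) ->
  exists a0, forall a, phi a0 <= phi a.
Proof.
move=> phic phiy; have [r Hr] := phiy (phi 0).
pose K := Num.max r 0.
have K0 : 0 <= K by rewrite le_max lexx orbT.
pose g (z : R * R) : R := phi (z.1 +i* z.2)%C.
pose A : set (R * R) := `[-K, K]%classic `*` `[-K, K]%classic.
have A00 : A (0, 0) by split; rewrite /= in_itv /= oppr_le0 K0.
have cA : compact A by apply: compact_setX; exact: segment_compact.
have gc : continuous g.
  move=> [x y]; apply/cvgrPdist_lt => e e0.
  have [d d0 Hd] := phic _ e0.
  have d20 : 0 < d / 2 by rewrite divr_gt0.
  exists (ball x (d / 2), ball y (d / 2)).
    by split; apply: nbhsx_ballx.
  move=> [x' y'] [/= bx by_]; apply: Hd.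
  rewrite /= (le_lt_trans (normc_le_abs _ _))// [d]splitr ltrD//.
have [||c cA0 Hc] := @compact_EVT_min _ R g A _ cA; first by exists (0, 0).
  exact: continuous_subspaceT.
exists (c.1 +i* c.2)%C => -[x y].
have [h|h] := ltP r (Normc.normc (x +i* y)%C).
  by apply: le_trans (Hr _ h); exact: (Hc (0, 0) (mem_set A00)).
have [hx hy] := abs_le_normc x y.
have hK : r <= K by rewrite le_max lexx.
apply: (Hc (x, y)); apply/mem_set.
by split; rewrite /= in_itv /= -ler_norml (le_trans _ (le_trans h hK)).
Qed.

Lemma interval_net (r d : R) : 0 < d ->
  exists t : seq R, forall x, `|x| <= r -> exists2 y, y \in t & `|x - y| < d.
Proof.
move=> d0; exists [seq k%:R * d - r | k <- iota 0 (Num.truncn ((r + r) / d)).+1].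
move=> x; rewrite ler_norml => /andP[x1 x2].
have xr : 0 <= (x + r) / d by rewrite divr_ge0 ?(ltW d0)// -lerBlDr sub0r.
exists ((Num.truncn ((x + r) / d))%:R * d - r).
  apply/mapP; exists (Num.truncn ((x + r) / d)) => //.
  by rewrite mem_iota add0n ltnS le_truncn// ler_pM2r ?invr_gt0// lerD2r.
have /andP[] := truncn_itv xr; move: (Num.truncn _) => k.
rewrite ler_pdivlMr// ltr_pdivrMr// -natr1 mulrDl mul1r => k1 k2.
by rewrite opprB addrA ger0_norm ?subr_ge0// ltrBlDl.
Qed.

Lemma disc_net (r e : R) : 0 < e ->
  exists t : seq R[i], forall a, cmodp a <= r -> exists2 c, c \in t & cmodp (a - c) < e.
Proof.
move=> e0; have d0 : 0 < e `^ p^-1 / 2 by rewrite divr_gt0// powR_gt0.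
have [t Ht] := interval_net (`|r| `^ p^-1) d0.
exists [seq (y +i* z)%C | y <- t, z <- t] => -[x y] xyr.
have rxy : Normc.normc (x +i* y)%C <= `|r| `^ p^-1.
  rewrite leNgt; apply/negP => /cmodp_gt H.
  by have := lt_le_trans (H (normr_ge0 _)) (le_trans xyr (ler_norm r)); rewrite ltxx.
have [hx hy] := abs_le_normc x y.
have [x' x't xx'] := Ht x (le_trans hx rxy).
have [y' y't yy'] := Ht y (le_trans hy rxy).
exists (x' +i* y')%C; first by apply/allpairsP; exists (x', y').
apply: cmodp_lt => //; apply: le_lt_trans (normc_le_abs _ _) _.
by rewrite [ltRHS]splitr ltrD.
Qed.

End Modulus.

(** * The Gelfand-Mazur argument for p-seminorms *)

Lemma expr_small {R : realType} (t e : R) : 0 <= t -> t < 1 -> 0 < e ->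
  exists k, forall n, (k <= n)%N -> t ^+ n < e.
Proof.
move=> t0 t1 e0.
have /cvgr0_norm_lt/(_ e e0) [k _ Hk] : (fun n => t ^+ n) @ \oo --> 0.
  by apply: cvg_expr; rewrite ger0_norm.
by exists k => n /Hk /=; rewrite ger0_norm// exprn_ge0.
Qed.

Lemma poly_right_ge0 {R : realType} (g : {poly R}) (d : R) : 0 < d ->
  (forall e, 0 < e -> e < d -> 0 <= g.[e]) -> 0 <= g.[0].
Proof.
move=> d0 gp; rewrite leNgt; apply/negP => g0.
have cg : (fun e => g.[e]) @ 0^'+ --> g.[0].
  by apply: cvg_at_right_filter; exact: continuous_horner.
have H1 : \forall e \near 0^'+, g.[e] < 0 by exact: (cvgr_lt _ cg _ g0).
have H2 : \forall e \near (0 : R)^'+, 0 < e := nbhs_right_gt 0.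
have H3 : \forall e \near 0^'+, e < d := nbhs_right_lt d0.
have [e [[He1 He2] He3]] := filter_ex (filterI (filterI H1 H2) H3).
by have := gp e He2 He3; rewrite leNgt He1.
Qed.

Section Growth.
Context {R : realType} (p : R).
Hypothesis p_gt0 : 0 < p.
Local Notation C := R[i].
Local Notation h := (cmodp p).
Variable f : {poly C} -> R.
Hypothesis f_ge0 : forall P, 0 <= f P.
Hypothesis fD : forall P Q, f (P + Q) <= f P + f Q.
Hypothesis fZ : forall (a : C) P, f (a *: P) <= h a * f P.
Variable M : R.
Hypothesis M_gt0 : 0 < M.
Hypothesis fX : forall P, f ('X * P) <= M * f P.
Hypothesis f_below : forall l : C, exists c : R, forall P, f P <= c * f (('X - l%:P) * P).
Implicit Types (P Q : {poly C}) (a b : R) (l s : C).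

(** In the ring of fractions of [C[X]] with the operator seminorm induced by [f],
    this bounds the powers of [1 / Q] by a multiple of those of [a]; the
    infimum of such [a] is the p-th power of the spectral radius of [1 / Q]. *)
Definition growth Q a := 0 < a /\
  exists2 K, 0 < K & forall k P, f P <= K * a ^+ k * f (Q ^+ k * P).

Lemma growth_le Q a b : a <= b -> growth Q a -> growth Q b.
Proof.
move=> ab [a0 [K K0 HK]]; split; first exact: lt_le_trans ab.
exists K => // k P; apply: le_trans (HK k P) _.
rewrite ler_wpM2r// ler_wpM2l ?(ltW K0)// lerXn2r// nnegrE ltW//.
exact: lt_le_trans ab.
Qed.

Lemma growthM Q1 Q2 a b : growth Q1 a -> growth Q2 b -> growth (Q1 * Q2) (a * b).
Proof.
move=> [a0 [K K0 HK]] [b0 [L L0 HL]]; split; first exact: mulr_gt0.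
exists (K * L); first exact: mulr_gt0.
move=> k P; apply: le_trans (HK k P) _.
rewrite !exprMn.
have -> : K * L * (a ^+ k * b ^+ k) * f (Q1 ^+ k * Q2 ^+ k * P) =
  K * a ^+ k * (L * b ^+ k * f (Q2 ^+ k * (Q1 ^+ k * P))).
  have -> : Q1 ^+ k * Q2 ^+ k * P = Q2 ^+ k * (Q1 ^+ k * P) by ring.
  by ring.
by rewrite ler_wpM2l// mulr_ge0 ?exprn_ge0 ?(ltW K0) ?(ltW a0).
Qed.

Lemma growthX Q a n : growth Q a -> growth (Q ^+ n) (a ^+ n).
Proof.
move=> [a0 [K K0 HK]]; split; first exact: exprn_gt0.
by exists K => // k P; rewrite -!exprM; exact: HK.
Qed.

(** The growth rate of a power determines that of its base: exponents that are
    not multiples of [n] cost at most [n] further one-step bounds. *)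
Lemma growth_root Q a n : (0 < n)%N -> (exists b, growth Q b) -> 0 < a ->
  growth (Q ^+ n) (a ^+ n) -> growth Q a.
Proof.
move=> n0 [b [b0 [L L0 HL]]] a0 [_ [K K0 HK]]; split=> //.
have ba0 : 0 <= b / a by rewrite divr_ge0 ?ltW.
exists (K * (L * (1 + b / a) ^+ n)).
  by rewrite !mulr_gt0// exprn_gt0// ltr_pwDl.
move=> k P; rewrite (divn_eq k n) mulnC; set q := (k %/ n)%N; set r := (k %% n)%N.
apply: le_trans (HK q P) _; rewrite -!exprM.
have -> : K * (L * (1 + b / a) ^+ n) * a ^+ (n * q + r) * f (Q ^+ (n * q + r) * P)
  = K * a ^+ (n * q) *
     (L * (1 + b / a) ^+ n * a ^+ r * f (Q ^+ r * (Q ^+ (n * q) * P))).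
  by rewrite [Q ^+ r * _]mulrA -exprD [(r + _)%N]addnC exprD; ring.
rewrite ler_wpM2l//; first by rewrite mulr_ge0 ?exprn_ge0 ?(ltW K0) ?(ltW a0).
apply: le_trans (HL r _) _.
rewrite ler_wpM2r// -!mulrA ler_wpM2l ?(ltW L0)//.
rewrite -[b in leLHS](divfK (lt0r_neq0 a0)) exprMn.
rewrite ler_wpM2r ?exprn_ge0 ?(ltW a0)//.
apply: (@le_trans _ _ ((1 + b / a) ^+ r)); first by rewrite lerXn2r ?nnegrE ?addr_ge0 ?lerDr.
by rewrite ler_weXn2l ?lerDl// ltnW// ltn_mod.
Qed.

(** The resolvent-like identity
    [1 / Q = (1 / (Q - s)) * (1 - s / Q)], read off from lower bounds. *)
Lemma growth_shift Q s a b : growth Q b -> growth (Q - s%:P) a ->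
  growth Q (a * (1 + h s * b)).
Proof.
move=> [b0 [K K0 HK]] [a0 [L L0 HL]].
have hb : 0 <= h s * b by rewrite mulr_ge0 ?cmodp_ge0 ?(ltW b0).
have b1 : 0 < 1 + h s * b by rewrite ltr_pwDl.
split; first exact: mulr_gt0.
exists (L * K); first exact: mulr_gt0.
move=> N P; apply: le_trans (HL N P) _.
rewrite exprMn -!mulrA ler_wpM2l ?(ltW L0)// mulrCA ler_wpM2l ?exprn_ge0 ?(ltW a0)//.
suff H k i : (k + i <= N)%N ->
    f ((Q - s%:P) ^+ k * (Q ^+ i * P)) <=
      K * (1 + h s * b) ^+ k * b ^+ (N - k - i) * f (Q ^+ N * P).
  have := H N 0%N; rewrite addn0 leqnn subnn subn0 expr0 !mul1r mulr1 => /(_ isT).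
  by rewrite mulrA.
elim: k i => [|k IH] i.
  rewrite add0n => iN; rewrite expr0 mul1r mulr1 subn0.
  apply: le_trans (HK (N - i)%N _) _.
  by rewrite mulrA -exprD subnK.
rewrite addSn => kiN.
have -> : (Q - s%:P) ^+ k.+1 * (Q ^+ i * P) =
   (Q - s%:P) ^+ k * (Q ^+ i.+1 * P) + (- s) *: ((Q - s%:P) ^+ k * (Q ^+ i * P)).
  rewrite exprS exprS -mul_polyC polyCN; ring.
apply: le_trans (fD _ _) _; apply: le_trans (lerD (IH _ _) (fZ _ _)) _.
  by rewrite addnS.
rewrite cmodpN.
apply: le_trans (lerD (lexx _) (ler_wpM2l (cmodp_ge0 _ _) (IH i (ltnW kiN)))) _.
rewrite le_eqVlt; apply/orP; left; apply/eqP.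
have -> : (N - k - i = (N - k - i.+1).+1)%N by rewrite -!subnDA addnS subnSK.
have -> : (N - k.+1 - i = N - k - i.+1)%N by rewrite -!subnDA addnS addSn.
by rewrite !exprS; ring.
Qed.


Lemma growth_exists l : exists a, growth ('X - l%:P) a.
Proof.
have [c Hc] := f_below l.
exists (Num.max c 1); split; first by rewrite lt_max ltr01 orbT.
exists 1 => // k; elim: k => [|k IH] P; first by rewrite !mul1r.
have c0 : 0 <= Num.max c 1 by rewrite le_max ler01 orbT.
apply: le_trans (IH P) _; rewrite !mul1r !exprSr.
rewrite -[leRHS]mulrA ler_wpM2l ?exprn_ge0//.
apply: le_trans (Hc _) _; rewrite -mulrA mulrCA.
by rewrite ler_wpM2r// le_max lexx.
Qed.

Lemma f_shift_le l P : f (('X - l%:P) * P) <= (M + h l) * f P.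
Proof.
rewrite mulrBl mulrDl; apply: le_trans (fD _ _) _.
by rewrite lerD// mul_polyC -scaleNr -(cmodpN p l).
Qed.

Section Nonzero.
Hypothesis f1 : 0 < f 1.

Lemma shift_gt0 l : 0 < M + h l.
Proof. by rewrite ltr_pwDl ?cmodp_ge0. Qed.

Lemma growth_lb l a : growth ('X - l%:P) a -> (M + h l)^-1 <= a.
Proof.
move=> [a0 [K K0 HK]]; have Ml := shift_gt0 l.
have H k : 1 <= K * (a * (M + h l)) ^+ k.
  rewrite -(ler_pM2r f1) mul1r; apply: le_trans (HK k 1) _.
  rewrite exprMn mulrA -[leRHS]mulrA ler_wpM2l ?mulr_ge0 ?exprn_ge0 ?(ltW K0) ?(ltW a0)//.
  elim: k => [|k IH]; first by rewrite !mul1r.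
  rewrite exprS -mulrA; apply: le_trans (f_shift_le _ _) _.
  by rewrite exprS -[leRHS]mulrA ler_wpM2l// ltW.
rewrite -(ler_pM2r Ml) mulVf ?gt_eqF// leNgt; apply/negP => lt1.
have [||k Hk] := expr_small _ lt1 (_ : 0 < K^-1); rewrite ?invr_gt0//.
  by rewrite mulr_ge0// ltW.
have := Hk k (leqnn k); rewrite -(ltr_pM2l K0) divff ?gt_eqF// => /lt_geF.
by rewrite H.
Qed.

Definition rate l := inf [set a | growth ('X - l%:P) a].

Lemma rate_has_inf l : has_inf [set a | growth ('X - l%:P) a].
Proof.
by split; [exact: growth_exists|exists (M + h l)^-1 => a; exact: growth_lb].
Qed.

Lemma rate_le l a : growth ('X - l%:P) a -> rate l <= a.
Proof. by move=> H; apply: ge_inf => //; case: (rate_has_inf l). Qed.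

Lemma growth_rate l a : rate l < a -> growth ('X - l%:P) a.
Proof.
by move=> /(inf_lt (growth_exists l))[b Hb ba]; apply: growth_le Hb; exact: ltW.
Qed.

Lemma rate_gt0 l : 0 < rate l.
Proof.
apply: (@lt_le_trans _ _ (M + h l)^-1); first by rewrite invr_gt0 shift_gt0.
by apply: lb_le_inf; [exact: growth_exists|move=> b; exact: growth_lb].
Qed.

Lemma rate_shift l m : rate m <= rate l * (1 + h (l - m) * rate m).
Proof.
pose g := ((rate l)%:P + 'X) * (1 + (h (l - m))%:P * ((rate m)%:P + 'X)) - (rate m)%:P.
suff : 0 <= g.[0] by rewrite !hornerE/= subr_ge0.
apply: (@poly_right_ge0 _ _ 1) => // e e0 _; rewrite !hornerE/= subr_ge0.
apply: rate_le; apply: growth_shift; first by apply: growth_rate; rewrite ltrDl.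
rewrite -addrA -opprD -polyCD [m + _]addrC subrK.
by apply: growth_rate; rewrite ltrDl.
Qed.

(** The reciprocal of the rate plays the role of the p-th power of the distance
    from [l] to a spectrum, which makes this estimate expected. *)
Lemma rateV_lip l m : `|(rate l)^-1 - (rate m)^-1| <= h (l - m).
Proof.
have H x y : (rate x)^-1 - (rate y)^-1 <= h (x - y).
  have [x0 y0] := (rate_gt0 x, rate_gt0 y).
  rewrite lerBlDl -(ler_pM2l x0) divff ?gt_eqF//.
  rewrite -(ler_pM2l y0) mulr1; apply: le_trans (rate_shift x y) _.
  rewrite le_eqVlt; apply/orP; left; apply/eqP.
  field; exact: lt0r_neq0.
by rewrite ler_norml H andbT lerNl opprB -(cmodpN p (l - m)) opprB H.
Qed.

Lemma rateV_ge l : h l - M <= (rate l)^-1.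
Proof.
have [hM|hM] := leP (h l) M.
  by apply: (@le_trans _ _ 0); rewrite ?subr_le0// invr_ge0 ltW// rate_gt0.
have hM0 : 0 < h l - M by rewrite subr_gt0.
have l0 : l != 0 by apply: contraTneq hM => ->; rewrite cmodp0// -leNgt ltW.
suff /rate_le H : growth ('X - l%:P) (h l - M)^-1.
  by rewrite -[h l - M]invrK lef_pV2// posrE ?invr_gt0// rate_gt0.
split; first by rewrite invr_gt0.
exists 1 => // k; elim: k => [|k IH] P; first by rewrite !mul1r.
apply: le_trans (IH P) _; rewrite !mul1r !exprSr -!mulrA.
rewrite ler_wpM2l ?exprn_ge0 ?invr_ge0 ?(ltW hM0)//.
rewrite [_ ^+ k * (_ * P)]mulrCA; move: (_ ^+ k * P) => {}P.
rewrite -(ler_pM2l hM0) mulrA divff ?gt_eqF// mul1r mulrBl lerBlDr.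
apply: (@le_trans _ _ (f (l *: P))).
  rewrite -(ler_pM2l (_ : 0 < (h l)^-1)) ?invr_gt0 ?cmodp_gt0//.
  rewrite mulrA mulVf ?gt_eqF ?cmodp_gt0// mul1r -cmodpV//.
  by rewrite -[P in leLHS]scale1r -(mulVf l0) -scalerA.
have -> : l *: P = 'X * P + (-1) *: (('X - l%:P) * P).
  rewrite -!mul_polyC polyCN; ring.
apply: le_trans (fD _ _) _; rewrite addrC lerD//.
by apply: le_trans (fZ _ _) _; rewrite cmodpN cmodp1 mul1r.
Qed.

Section Maximum.
Variable l0 : C.
Hypothesis l0_max : forall l, rate l <= rate l0.
Local Notation m := (rate l0).

(** Exponents that are powers of two make the splitting of [Y ^ n - c] into
    translates of [Y] a mere iteration of complex square roots. *)
Lemma growth_split b j l c : m < b ->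
  growth (('X - l%:P) ^+ (2 ^ j) - c%:P) (b ^+ (2 ^ j)).
Proof.
move=> mb; elim: j c => [|j IH] c.
  rewrite !expr1 -addrA -opprD -polyCD.
  by apply: growth_rate; exact: le_lt_trans mb.
have := growthM (IH (sqrtc c)) (IH (- sqrtc c)).
rewrite -expr2 -exprM -expnSr polyCN opprK -subr_sqr -exprM -expnSr -polyC_exp.
by rewrite sqr_sqrtc.
Qed.

Lemma growth_split_one a b j s : m < b -> growth ('X - (l0 + s)%:P) a ->
  growth (('X - l0%:P) ^+ (2 ^ j) - (s ^+ (2 ^ j))%:P) (a * b ^+ (2 ^ j).-1).
Proof.
move=> mb Ha; elim: j => [|j IH].
  by rewrite !expr1 mulr1 -addrA -opprD -polyCD.
have := growthM IH (growth_split j l0 (- s ^+ (2 ^ j)) mb).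
rewrite polyCN opprK -subr_sqr -exprM -expnSr -polyC_exp -exprM -expnSr -mulrA -exprD.
have -> : ((2 ^ j).-1 + 2 ^ j = (2 ^ j.+1).-1)%N.
  by rewrite expnS mul2n -addnn; case: (2 ^ j)%N (expn_gt0 2 j).
by [].
Qed.

(** A maximum of the rate spreads over a disc whose radius depends on the
    maximal value only.  If [rate (l0 + s) < m], one small factor in
    [(X - l0) ^ n - s ^ n] would make the rate of [(X - l0) ^ n] smaller than
    [m ^ n], the perturbation by [s ^ n] being negligible for large [n]. *)
Lemma rate_max_disc s : h s * m < 1 -> rate (l0 + s) = m.
Proof.
move=> hs; apply/eqP; rewrite eq_le l0_max /= leNgt; apply/negP => lt_m.
have m0 : 0 < m := rate_gt0 l0.
have [a ra am] : exists2 a, rate (l0 + s) < a & a < m.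
  by exists ((rate (l0 + s) + m) / 2); rewrite (midf_lt lt_m).
have a0 : 0 < a by apply: lt_trans ra; exact: rate_gt0.
have Ha := growth_rate ra.
have hs0 : 0 <= h s * m by rewrite mulr_ge0 ?cmodp_ge0 ?(ltW m0).
have [k Hk] : exists k, forall n, (k <= n)%N -> (h s * m) ^+ n < m / a - 1.
  by apply: expr_small => //; rewrite subr_gt0 ltr_pdivlMr// mul1r.
have {Hk} := Hk (2 ^ k)%N (ltnW (ltn_expl k (isT : (1 < 2)%N))).
have n0 := expn_gt0 2 k; rewrite /= in n0.
set n := (2 ^ k)%N in n0 *; move=> Hn.
pose g := a *: ((m%:P + 'X) ^+ n.-1 * (1 + (h s)%:P ^+ n * (m%:P + 'X) ^+ n))
            - (m%:P - 'X) ^+ n.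
suff : 0 <= g.[0].
  rewrite !hornerE/= subr0 subr_ge0 -mulrA leNgt => /negP; apply.
  rewrite -exprMn -[X in _ < _ ^+ X](prednK n0) exprS mulrCA [m * _]mulrC.
  by rewrite ltr_pM2l ?exprn_gt0// -ltr_pdivlMl// addrC [a^-1 * _]mulrC -ltrBrDr.
apply: (poly_right_ge0 m0) => e e0 em; rewrite !hornerE/= subr_ge0 leNgt.
apply/negP => /ltW H.
have me0 : 0 < m - e by rewrite subr_gt0.
have mme : m < m + e by rewrite ltrDl.
have G1 := growth_split_one k mme Ha.
have G2 := growthX n (growth_rate mme).
have := growth_shift G2 G1; rewrite cmodpX => /(growth_le H).
move=> /(growth_root n0 (growth_exists _) me0) /rate_le.
by rewrite lerDl oppr_ge0 leNgt e0.
Qed.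

End Maximum.

End Nonzero.

(** Nonemptiness of the approximate point spectrum, in a form that applies
    without any convexity.  By [rate_max_disc] the maximal value of [rate] is
    taken at equally spaced points along a ray, whereas [rate] tends to zero at
    infinity. *)
Theorem shifts_below_eq0 : f 1 = 0.
Proof.
apply/eqP; rewrite eq_le f_ge0 andbT leNgt; apply/negP => f1.
have [||l0 Hl0] := @coercive_min R (fun l => (rate l)^-1).
- move=> e e0; exists (e `^ p^-1); first exact: powR_gt0.
  by move=> a b ab; apply: le_lt_trans (rateV_lip f1 a b) _; exact: cmodp_lt.
- move=> K; exists ((`|K| + M) `^ p^-1) => a Ha.
  apply: le_trans (rateV_ge f1 a); rewrite lerBrDr.
  apply: (@le_trans _ _ (`|K| + M)); first by rewrite lerD2r ler_norm.
  by apply/ltW/cmodp_gt => //; rewrite addr_ge0// ltW.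
have r0 := rate_gt0 f1 l0.
have Hmax l : rate l <= rate l0 by rewrite -lef_pV2 ?posrE ?rate_gt0.
have [s s0 hs] : exists2 s : R, 0 <= s & h (s%:C)%C = (rate l0)^-1 / 2.
  by apply: cmodp_surj => //; rewrite divr_ge0// invr_ge0 ltW.
have sgt : 0 < s.
  rewrite lt_neqAle s0 andbT; apply/eqP => E; move: hs.
  by rewrite -E cmodp0// => /eqP; rewrite eq_sym gt_eqF// divr_gt0// invr_gt0.
have H k : rate (l0 + k%:R * (s%:C)%C) = rate l0.
  elim: k => [|k IH]; first by rewrite mul0r addr0.
  rewrite -IH -natr1 mulrDl mul1r addrA; apply: (rate_max_disc f1).
    by move=> l; rewrite IH.
  by rewrite IH hs mulrAC mulVf ?gt_eqF// mul1r invf_lt1// ltr1n.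
have [k Hk] : exists k : nat, (rate l0)^-1 < h (l0 + k%:R * (s%:C)%C) - M.
  pose r := ((rate l0)^-1 + M) `^ p^-1.
  have r00 : 0 <= (rate l0)^-1 + M by rewrite addr_ge0 ?invr_ge0 ?ltW.
  exists (Num.truncn ((r + Normc.normc l0) / s)).+1; set k := _.+1.
  rewrite ltrBrDr; apply: cmodp_gt => //; rewrite -/r.
  have : r + Normc.normc l0 < k%:R * s.
    by rewrite -ltr_pdivrMr// truncnS_gt.
  have <- : Normc.normc (k%:R * (s%:C)%C) = k%:R * s.
    rewrite -(rmorph_nat (real_complex R)) -rmorphM /= expr0n /= addr0.
    by rewrite sqrtr_sqr ger0_norm// mulr_ge0.
  rewrite -ltrBrDr => /lt_le_trans; apply; rewrite lerBlDr.
  rewrite -[X in Normc.normc X <= _](addrK l0) [_ * _ + _]addrC.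
  by apply: le_trans (@le_normcD R _ _) _; rewrite (@normcN R).
have := rateV_ge f1 (l0 + k%:R * (s%:C)%C).
by rewrite leNgt H Hk.
Qed.

End Growth.

(** * The p-th power of the quasi-norm *)

Lemma geom_small {R : realType} (K e : R) : 0 < e ->
  exists k, forall n, (k <= n)%N -> K / 2 ^+ n < e.
Proof.
move=> e0; have K0 : 0 < 1 + `|K| by rewrite ltr_pwDl.
have [k Hk] : exists k, forall n, (k <= n)%N -> 2^-1 ^+ n < e / (1 + `|K|).
  by apply: expr_small; rewrite ?invr_ge0 ?divr_gt0 ?invf_lt1 ?ltr1n.
exists k => n /Hk; rewrite exprVn ltr_pdivlMr// => Hn.
apply: le_lt_trans Hn; rewrite mulrC ler_wpM2l ?invr_ge0 ?exprn_ge0//.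
by rewrite (le_trans (ler_norm _))// lerDr.
Qed.

Section PNorm.
Context {R : realType} (p : R) (X : quasiBanachType R).
Hypotheses (p_gt0 : 0 < p) (hsub : p_subadditive X p).
Local Notation C := R[i].
Local Notation h := (cmodp p).
Implicit Types (x y z : X) (a : C) (V W : set X).

(** Working with the p-th power makes the quasi-norm subadditive. *)
Definition qp x : R := qnorm x `^ p.
Local Notation q := qp.

Lemma qp_ge0 x : 0 <= q x. Proof. exact: powR_ge0. Qed.

Lemma qp_eq0 x : q x = 0 -> x = 0.
Proof. by move=> /powR_eq0_eq0; exact: qnorm0_eq0. Qed.

Lemma qpD x y : q (x + y) <= q x + q y. Proof. exact: hsub. Qed.

Lemma qpZ a x : q (a *: x) = h a * q x.
Proof. by rewrite /qp qnormZ powRM// ?normc_ge0 ?qnorm_ge0. Qed.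

Lemma qp0 : q 0 = 0.
Proof. by rewrite -(scale0r (0 : X)) qpZ cmodp0// mul0r. Qed.

Lemma qpN x : q (- x) = q x.
Proof. by rewrite -scaleN1r qpZ cmodpN cmodp1 mul1r. Qed.

Lemma qpB x y : q (x - y) <= q x + q y.
Proof. by rewrite -(qpN y); exact: qpD. Qed.

Lemma qpC x y : q (x - y) = q (y - x).
Proof. by rewrite -opprB qpN. Qed.

Lemma qp_tri z x y : q (x - y) <= q (x - z) + q (z - y).
Proof. by apply: le_trans (qpD _ _); rewrite addrA subrK. Qed.

Lemma qp_gt0 x : x != 0 -> 0 < q x.
Proof.
move=> x0; rewrite lt_neqAle qp_ge0 andbT eq_sym.
by apply: contra x0 => /eqP/qp_eq0 ->.
Qed.

Lemma qp_lt x e : 0 <= e -> (q x < e `^ p) = (qnorm x < e).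
Proof.
move=> e0; apply/idP/idP => [|xe]; last by rewrite gt0_ltr_powR ?nnegrE ?qnorm_ge0.
by apply: contraTT; rewrite -!leNgt => ?; rewrite ge0_ler_powR ?nnegrE ?qnorm_ge0 ?(ltW p_gt0).
Qed.

Lemma qp_ball_entourage (A : set (X * X)) :
  entourage A <-> exists2 e, 0 < e & forall x y, q (x - y) < e -> A (x, y).
Proof.
rewrite qnorm_entourageE; split=> [[e /= e0 He]|[e e0 He]].
  exists (e `^ p); first exact: powR_gt0.
  by move=> x y; rewrite qp_lt ?ltW// => xy; exact: (He (x, y)).
exists (e `^ p^-1) => /=; first exact: powR_gt0.
move=> [x y] /= xy; apply: He; rewrite -(powRr1 (ltW e0)) -(mulVf (lt0r_neq0 p_gt0)).
by rewrite powRrM qp_lt// powR_ge0.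
Qed.

Lemma qp_nbhs x (A : set X) :
  nbhs x A <-> exists2 e, 0 < e & forall y, q (x - y) < e -> A y.
Proof.
rewrite -nbhs_entourageE; split=> [[E /qp_ball_entourage[e e0 He] EA]|[e e0 He]].
  by exists e => // y xy; apply: EA; apply/xsectionP; exact: He.
exists [set xy | q (xy.1 - xy.2) < e]; first by apply/qp_ball_entourage; exists e.
by move=> y /xsectionP/= ?; exact: He.
Qed.

Lemma qp_closed (A : set X) :
  (forall x, (forall e, 0 < e -> exists2 y, A y & q (x - y) < e) -> A x) -> closed A.
Proof.
move=> H x clx; apply: H => e e0.
have [|y [Ay /= xy]] := clx [set y | q (x - y) < e]; last by exists y.
by apply/qp_nbhs; exists e.
Qed.

Lemma geom_sum_le (u : nat -> X) (K : R) :
  (forall n, q (u n.+1 - u n) <= K / 2 ^+ n) ->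
  forall n m, (n <= m)%N -> q (u m - u n) <= 2 * K / 2 ^+ n.
Proof.
move=> H; have K0 : 0 <= K.
  by have := le_trans (qp_ge0 _) (H 0%N); rewrite expr0 divr1.
have H2 n k : q (u (n + k)%N - u n) <= 2 * K / 2 ^+ n - 2 * K / 2 ^+ (n + k).
  elim: k => [|k IH]; first by rewrite addn0 !subrr qp0.
  rewrite addnS; apply: le_trans (qp_tri (u (n + k)%N) _ _) _.
  apply: le_trans (lerD (H _) IH) _; rewrite exprS.
  have p0 : 2 ^+ (n + k) != 0 :> R by rewrite expf_neq0.
  have -> : 2 * K / (2 * 2 ^+ (n + k)) = K / 2 ^+ (n + k) by field.
  by rewrite -[2 * K / 2 ^+ (n + k)]mulrA; lra.
move=> n m nm; rewrite -(subnKC nm); apply: le_trans (H2 _ _) _.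
by rewrite gerBl !mulr_ge0// invr_ge0 exprn_ge0.
Qed.

Lemma qp_complete (u : nat -> X) (K : R) :
  (forall n, q (u n.+1 - u n) <= K / 2 ^+ n) ->
  exists l, forall n, q (l - u n) <= 2 * K / 2 ^+ n.
Proof.
move=> H; have Hg := geom_sum_le H.
have [l Hl] : exists l : X, u @ \oo --> l.
  apply: qcauchy_cvg => A /qp_ball_entourage[e e0 He].
  have [k Hk] := geom_small (2 * K) (divr_gt0 e0 (@ltr0n _ 2)).
  have Fk : (u @ \oo) [set x | q (x - u k) < e / 2].
    by exists k => // n /= kn; apply: le_lt_trans (Hg _ _ kn) (Hk _ _).
  exists ([set x | q (x - u k) < e / 2], [set x | q (x - u k) < e / 2]) => //.
  move=> [x y] /= [xk yk]; apply: He; apply: le_lt_trans (qp_tri (u k) _ _) _.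
  by rewrite [e]splitr ltrD// qpC.
exists l => n; apply/ler_addgt0Pr => e e0.
have /Hl [k _ Hk] : nbhs l [set y | q (l - y) < e] by apply/qp_nbhs; exists e.
apply: le_trans (qp_tri (u (maxn k n)) _ _) _; rewrite addrC.
apply: lerD; first exact: Hg (leq_maxr _ _).
by apply/ltW/Hk; exact: leq_maxl.
Qed.

(** * Finite-dimensional subspaces *)

Lemma subspace0 V : is_subspace V -> V 0. Proof. by case. Qed.

Lemma subspaceZ V a x : is_subspace V -> V x -> V (a *: x).
Proof. by move=> [V0 HV] Vx; rewrite -[_ *: _]addr0; exact: HV. Qed.

Lemma subspaceD V x y : is_subspace V -> V x -> V y -> V (x + y).
Proof. by move=> [V0 HV] Vx Vy; rewrite -[x]scale1r; exact: HV. Qed.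

Lemma subspaceB V x y : is_subspace V -> V x -> V y -> V (x - y).
Proof.
by move=> HV Vx Vy; rewrite -scaleN1r; apply: subspaceD => //; exact: subspaceZ.
Qed.

(** Spanning lists are peeled one vector at a time, which is the shape of all
    the inductions on the dimension below. *)
Fixpoint span_seq (s : seq X) : set X :=
  if s is b :: s' then [set x | exists c : C, span_seq s' (x - c *: b)]
  else [set 0].

Lemma span_seq_subspace s : is_subspace (span_seq s).
Proof.
elim: s => [|b s IH] /=; first by split=> // a x y -> ->; rewrite scaler0 addr0.
split; first by exists 0; rewrite scale0r subr0; exact: subspace0.
move=> a x y [c xc] [d yd]; exists (a * c + d).
have -> : a *: x + y - (a * c + d) *: b = a *: (x - c *: b) + (y - d *: b).
  by rewrite scalerBr scalerDl scalerA opprD addrACA.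
by apply: subspaceD => //; exact: subspaceZ.
Qed.

Lemma span_seq_cons b s x : span_seq s x -> span_seq (b :: s) x.
Proof. by move=> sx; exists 0; rewrite scale0r subr0. Qed.

Lemma span_seq_mem s x : x \in s -> span_seq s x.
Proof.
elim: s => [//|b s IH]; rewrite inE => /predU1P[->|/IH]; last exact: span_seq_cons.
by exists 1; rewrite scale1r subrr; exact: (subspace0 (span_seq_subspace s)).
Qed.

Lemma span_seq_sub s V : is_subspace V -> (forall b, b \in s -> V b) -> span_seq s `<=` V.
Proof.
move=> HV; elim: s => [|b s IH] sV x /=; first by move=> ->; exact: subspace0.
move=> [c xc]; rewrite -(subrK (c *: b) x); apply: subspaceD => //.
  by apply: IH => // y ys; apply: sV; rewrite inE ys orbT.
by apply: subspaceZ => //; apply: sV; rewrite inE eqxx.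
Qed.

Lemma finite_dim_span V : finite_dim V ->
  exists2 s, (forall b, b \in s -> V b) & V `<=` span_seq s.
Proof.
move=> [n [b [bV HV]]]; exists [seq b i | i <- enum 'I_n].
  by move=> _ /mapP[i _ ->].
move=> x /HV[c ->]; have HS := span_seq_subspace [seq b i | i <- enum 'I_n].
apply: (big_ind (span_seq [seq b i | i <- enum 'I_n])); first exact: subspace0.
  by move=> y z; exact: subspaceD.
by move=> i _; apply: subspaceZ => //; apply/span_seq_mem/mapP; exists i; rewrite ?mem_enum.
Qed.

Lemma span_seq_coef s x : span_seq s x ->
  exists c : nat -> C, x = \sum_(i < size s) c i *: s`_i.
Proof.
elim: s x => [x /= ->|b s IH x [c /IH[d xd]]]; first by exists (fun=> 0); rewrite big_ord0.
exists (fun i => if i is j.+1 then d j else c).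
by rewrite big_ord_recl /= -xd addrC subrK.
Qed.

Lemma span_finite_dim V s : (forall b, b \in s -> V b) -> V `<=` span_seq s ->
  finite_dim V.
Proof.
move=> sV Vs; exists (size s), (fun i => s`_i); split.
  by move=> i; apply/sV/mem_nth.
by move=> x /Vs/span_seq_coef[c xc]; exists (fun i => c i).
Qed.

(** The definition of [finite_dim] asks for generators inside the subspace, so
    passing to subspaces requires an elimination step. *)
Lemma sub_span_finite_dim V s : is_subspace V -> V `<=` span_seq s -> finite_dim V.
Proof.
move=> HV Vs; suff [t tV Vt] : exists2 t, (forall b, b \in t -> V b) & V `<=` span_seq t.
  exact: span_finite_dim tV Vt.
elim: s V HV Vs => [|b s IH] V HV Vs; first by exists [::].
have HS := span_seq_subspace s.
have [||t tV Vt] := IH (V `&` span_seq s); [|exact: subIsetr|].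
  split; first by split; exact: subspace0.
  move=> a x y [Vx sx] [Vy sy].
  by split; apply: subspaceD => //; exact: subspaceZ.
have [Vss|/existsNP[v /not_implyP[Vv vs]]] := pselect (V `<=` span_seq s).
  by exists t => [x /tV[]//|x Vx]; apply: Vt; split=> //; exact: Vss.
have [a va] := Vs _ Vv.
have a0 : a != 0 by apply: contra_notN vs => /eqP a0; rewrite a0 scale0r subr0 in va.
exists (v :: t) => [x|x Vx]; first by rewrite inE => /predU1P[->//|/tV[]].
have [c xc] := Vs _ Vx; exists (c / a); apply: Vt; split.
  by apply: subspaceB => //; exact: subspaceZ.
have -> : x - (c / a) *: v = (x - c *: b) - (c / a) *: (v - a *: b).
  by rewrite scalerBr scalerA divfK// opprB addrA subrK.
by apply: subspaceB => //; exact: subspaceZ.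
Qed.

Lemma sub_finite_dim V W : is_subspace V -> V `<=` W -> finite_dim W -> finite_dim V.
Proof.
move=> HV VW /finite_dim_span[s _ Ws].
exact: sub_span_finite_dim HV (subset_trans VW Ws).
Qed.

Definition sdist s x := inf [set q (x - y) | y in span_seq s].

Lemma sdist_has_inf s x : has_inf [set q (x - y) | y in span_seq s].
Proof.
split; first by exists (q (x - 0)); exists 0 => //; exact: (subspace0 (span_seq_subspace s)).
by exists 0 => _ [y _ <-]; exact: qp_ge0.
Qed.

Lemma sdist_le s x y : span_seq s y -> sdist s x <= q (x - y).
Proof. by move=> sy; apply: ge_inf; [case: (sdist_has_inf s x)|exists y]. Qed.

Lemma sdist_ge s x (d : R) : (forall y, span_seq s y -> d <= q (x - y)) -> d <= sdist s x.
Proof.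
by move=> H; apply: lb_le_inf; [case: (sdist_has_inf s x)|move=> _ [y /H ? <-]].
Qed.

Lemma sdist_lip s x y : sdist s x <= sdist s y + q (x - y).
Proof.
rewrite -lerBlDr; apply: sdist_ge => z sz; rewrite lerBlDr.
by apply: le_trans (sdist_le x sz) _; rewrite [leRHS]addrC; exact: qp_tri.
Qed.

Lemma sdistZ_le s a x : h a * sdist s x <= sdist s (a *: x).
Proof.
have [->|a0] := eqVneq a 0.
  by rewrite cmodp0// mul0r; apply: sdist_ge => *; exact: qp_ge0.
apply: sdist_ge => y sy.
have -> : a *: x - y = a *: (x - a^-1 *: y) by rewrite scalerBr scalerA divff// scale1r.
rewrite qpZ ler_wpM2l ?cmodp_ge0//; apply: sdist_le.
exact: (subspaceZ _ (span_seq_subspace s)).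
Qed.

(** In the inductive step the distance of [x - a *: b] from the smaller space is a
    continuous coercive function of [a], so it has a minimum, which is positive
    by induction.  This is the closedness of finite-dimensional subspaces. *)
Lemma sdist_gt0 s x : ~ span_seq s x -> 0 < sdist s x.
Proof.
elim: s x => [|b s IH] x sx.
  apply: (@lt_le_trans _ _ (q x)); first by apply: qp_gt0; apply/eqP.
  by apply: sdist_ge => y /= ->; rewrite subr0.
have [sb|/IH db] := pselect (span_seq s b).
  apply: lt_le_trans (IH x _) _; first by move/(@span_seq_cons b).
  apply: sdist_ge => y [c yc]; apply: sdist_le; rewrite -(subrK (c *: b) y).
  by have HS := span_seq_subspace s; apply: subspaceD => //; exact: subspaceZ.
have [||a0 Ha0] := @coercive_min R (fun a => sdist s (x - a *: b)).
- move=> e e0; exists ((e / (1 + q b)) `^ p^-1).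
    by rewrite powR_gt0// divr_gt0// ltr_pwDl ?qp_ge0.
  have H a c : sdist s (x - a *: b) - sdist s (x - c *: b) <= h (a - c) * q b.
    rewrite lerBlDl; apply: le_trans (sdist_lip s _ (x - c *: b)) _.
    rewrite lerD2l opprB [_ + (_ - x)]addrC addrA subrK -scalerBl.
    by rewrite qpZ -(cmodpN p (a - c)) opprB.
  move=> a c ac; apply: (@le_lt_trans _ _ (h (a - c) * q b)).
    by rewrite ler_norml H andbT lerNl opprB -(cmodpN p (a - c)) opprB H.
  have /(cmodp_lt p_gt0) := ac; rewrite divr_gt0 ?ltr_pwDl ?qp_ge0// => /(_ isT).
  rewrite ltr_pdivlMr ?ltr_pwDl ?qp_ge0//; apply: le_lt_trans.
  by rewrite ler_wpM2l ?cmodp_ge0// lerDr.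
- move=> K; exists (((`|K| + q x) / sdist s b) `^ p^-1) => a.
  have Kx : 0 <= `|K| + q x by rewrite addr_ge0// qp_ge0.
  move=> /(cmodp_gt p_gt0) H; have {H} := H (divr_ge0 Kx (ltW db)).
  rewrite ltr_pdivrMr// => /ltW H; apply: le_trans (ler_norm K) _.
  rewrite -(lerD2r (q x)); apply: le_trans H _; apply: le_trans (sdistZ_le _ _ _) _.
  apply: le_trans (sdist_lip _ _ (a *: b - x)) _.
  have -> : a *: b - (a *: b - x) = x by rewrite opprB addrCA subrr addr0.
  rewrite lerD2r.
  by have := sdistZ_le s (-1) (a *: b - x); rewrite cmodpN cmodp1 mul1r scaleN1r opprB.
have Hc a : ~ span_seq s (x - a *: b) by move=> H; apply: sx; exists a.
apply: lt_le_trans (IH _ (Hc a0)) _; apply: sdist_ge => y [c yc].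
apply: le_trans (Ha0 c) _; apply: le_trans (sdist_le _ yc) _.
by rewrite opprB addrA subrK.
Qed.

(** By induction: the coordinate along a new vector is bounded because [sdist] is
    positive, so it ranges over a disc, and the remaining part is bounded too. *)
Lemma bounded_span_net s (K e : R) : 0 < e ->
  exists t : seq X, forall x, span_seq s x -> q x <= K ->
    exists2 y, y \in t & q (x - y) <= e.
Proof.
elim: s K e => [|b s IH] K e e0.
  by exists [:: 0] => x /= -> _; exists 0; rewrite ?mem_head// subr0 qp0 ltW.
have HS := span_seq_subspace s.
have [sb|/sdist_gt0 db] := pselect (span_seq s b).
  have [t Ht] := IH K e e0; exists t => x [c xc] xK; apply: Ht => //.
  by rewrite -(subrK (c *: b) x); apply: subspaceD => //; exact: subspaceZ.
have e2 : 0 < e / 2 by rewrite divr_gt0.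
have b1 : 0 < 1 + q b by rewrite ltr_pwDl ?qp_ge0.
have [t Ht] := IH (K + K / sdist s b * q b) (e / 2) e2.
have [u Hu] := disc_net p_gt0 (K / sdist s b) (divr_gt0 e2 b1).
exists [seq y + c *: b | y <- t, c <- u] => x [c xc] xK.
have cK : h c <= K / sdist s b.
  rewrite ler_pdivlMr//; apply: le_trans (sdistZ_le _ _ _) _; apply: le_trans xK.
  apply: le_trans (sdist_le _ (subspaceZ (-1) HS xc)) _.
  by rewrite scaleN1r opprK addrC subrK.
have [|y yt xy] := Ht _ xc.
  by apply: le_trans (qpB _ _) _; rewrite lerD// qpZ ler_wpM2r ?qp_ge0.
have [d du cd] := Hu _ cK.
exists (y + d *: b); first by apply/allpairsP; exists (y, d).
have -> : x - (y + d *: b) = (x - c *: b - y) + (c - d) *: b.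
  by rewrite scalerBl opprD addrA [x - _ - y]addrAC [RHS]addrA subrK.
apply: le_trans (qpD _ _) _; rewrite [e]splitr lerD// qpZ.
move: cd; rewrite ltr_pdivlMr// => /ltW; apply: le_trans.
by rewrite ler_wpM2l ?cmodp_ge0// lerDr.
Qed.


(** * The measure of noncompactness of a bounded family *)

Section Noncompactness.
Variable I : Type.
Implicit Types u v : I -> X.

Definition bounded_family u := exists K : R, forall i, q (u i) <= K.

Definition covered u (r : R) :=
  exists t : seq X, forall i, exists2 y, y \in t & q (u i - y) <= r.

Definition noncompactness u := inf [set r | 0 <= r /\ covered u r].
Local Notation alpha := noncompactness.

Lemma noncompactness_ge0 u : 0 <= alpha u.
Proof.
rewrite /alpha; have [->|/set0P S0] := eqVneq [set r | 0 <= r /\ covered u r] set0.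
  by rewrite inf0.
by apply: lb_le_inf => // r [].
Qed.

Lemma noncompactness_le u (r : R) : 0 <= r -> covered u r -> alpha u <= r.
Proof. by move=> r0 ur; apply: ge_inf; [exists 0 => s []|split]. Qed.

Lemma noncompactness_approx u (e : R) : bounded_family u -> 0 < e ->
  exists r, [/\ 0 <= r, covered u r & r < alpha u + e].
Proof.
move=> [K HK] e0.
have [||r [r0 ur] rlt] := @inf_lt R [set r | 0 <= r /\ covered u r] (alpha u + e).
- exists `|K|; split=> //; exists [:: 0] => i; exists 0; first exact: mem_head.
  by rewrite subr0 (le_trans (HK i))// ler_norm.
- by rewrite ltrDl.
by exists r.
Qed.

Lemma noncompactnessD u v : bounded_family u -> bounded_family v ->
  alpha (fun i => u i + v i) <= alpha u + alpha v.
Proof.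
move=> bu bv; apply/ler_addgt0Pr => e e0; have e2 : 0 < e / 2 by rewrite divr_gt0.
have [r [r0 [t Ht] re]] := noncompactness_approx bu e2.
have [s [s0 [t' Ht'] se]] := noncompactness_approx bv e2.
apply: (@le_trans _ _ (r + s)); last first.
  by rewrite [e]splitr addrACA; apply: lerD; apply: ltW.
apply: noncompactness_le; first exact: addr_ge0.
exists [seq y + z | y <- t, z <- t'] => i.
have [y yt uy] := Ht i; have [z zt vz] := Ht' i.
exists (y + z); first by apply/allpairsP; exists (y, z).
by rewrite opprD addrACA; apply: le_trans (qpD _ _) _; exact: lerD.
Qed.

Lemma bounded_family_op (T : X -> X) (M : R) u : 0 <= M ->
  (forall x, q (T x) <= M * q x) -> bounded_family u ->
  bounded_family (fun i => T (u i)).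
Proof.
move=> M0 HM [K HK]; exists (M * K) => i.
by apply: le_trans (HM _) _; exact: ler_wpM2l.
Qed.

Lemma noncompactness_op (T : {additive X -> X}) (M : R) u : 0 <= M ->
  (forall x, q (T x) <= M * q x) -> bounded_family u ->
  alpha (fun i => T (u i)) <= M * alpha u.
Proof.
move=> M0 HM bu; apply/ler_addgt0Pr => e e0.
have M1 : 0 < 1 + M by rewrite ltr_pwDl.
have [r [r0 [t Ht] re]] := noncompactness_approx bu (divr_gt0 e0 M1).
apply: (@le_trans _ _ (M * r)); last first.
  apply: le_trans (ler_wpM2l M0 (ltW re)) _; rewrite mulrDr lerD2l.
  by rewrite mulrCA ger_pMr// ler_pdivrMr// mul1r lerDr.
apply: noncompactness_le; first exact: mulr_ge0.
exists [seq T y | y <- t] => i; have [y yt uy] := Ht i.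
exists (T y); first exact: map_f.
by rewrite -raddfB; apply: le_trans (HM _) _; exact: ler_wpM2l.
Qed.

(** A net for [S u] lifts to one for [u] up to bounded parts of the kernel, and
    these are totally bounded. *)
Lemma noncompactness_below (S : {linear X -> X}) (M c : R) u :
  0 <= M -> (forall x, q (S x) <= M * q x) ->
  0 <= c -> (forall x, exists2 y, S y = 0 & q (x - y) <= c * q (S x)) ->
  finite_dim [set x | S x = 0] -> bounded_family u ->
  alpha u <= 2 * c * alpha (fun i => S (u i)).
Proof.
move=> M0 HM c0 HS /finite_dim_span[s _ kers] bu.
have bSu := bounded_family_op M0 HM bu.
apply/ler_addgt0Pr => e e0; have c1 : 0 < 2 * c + 1 by rewrite ltr_wpDl// mulr_ge0.
have d0 := divr_gt0 e0 c1.
have [r [r0 [t Ht] re]] := noncompactness_approx bSu d0.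
set d := e / (2 * c + 1) in d0 re.
apply: (@le_trans _ _ (2 * c * r + d)); last first.
  apply: (@le_trans _ _ (2 * c * (alpha (fun i => S (u i)) + d) + d)).
    by rewrite lerD2r ler_wpM2l ?mulr_ge0// ltW.
  by rewrite mulrDr -addrA lerD2l -[X in _ + X]mul1r -mulrDl /d mulrC divfK// gt_eqF.
apply: noncompactness_le; first by rewrite addr_ge0 ?(ltW d0)// !mulr_ge0.
have [K HK] := bu.
pose near_rep y x := exists2 i, x = u i & q (S (u i) - y) <= r.
have [rep Hrep] : {rep : X -> X & forall y i, q (S (u i) - y) <= r -> near_rep y (rep y)}.
  apply: (@choice _ _ (fun y x => forall i, q (S (u i) - y) <= r -> near_rep y x)) => y.
  have [[i iy]|no] := pselect (exists i, q (S (u i) - y) <= r).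
    by exists (u i) => _ _; exists i.
  by exists 0 => i iy; case: no; exists i.
have [n Hn] := bounded_span_net s (K + K + 2 * c * r) d0.
exists [seq y + z | y <- [seq rep y | y <- t], z <- n] => i.
have [y yt Sy] := Ht i; have [j repj Sj] := Hrep _ _ Sy.
have [k Sk uk] := HS (u i - u j).
have uk2 : q (u i - u j - k) <= 2 * c * r.
  apply: le_trans uk _; rewrite [2 * c]mulrC -mulrA ler_wpM2l//.
  rewrite raddfB mulr_natl mulr2n; apply: le_trans (qp_tri y _ _) _.
  by rewrite lerD// qpC.
have [|z zn kz] := Hn k (kers _ Sk).
  rewrite -[k](subKr (u i - u j)); apply: le_trans (qpB _ _) _; rewrite lerD//.
  by apply: le_trans (qpB _ _) _; rewrite lerD.
exists (rep y + z); first by apply/allpairsP; exists (rep y, z); split=> //; exact: map_f.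
rewrite repj opprD addrA; apply: le_trans (qp_tri k _ _) _.
by rewrite lerD.
Qed.

End Noncompactness.

(** The unit ball is indexed by the whole space, so that no sequence has to be
    extracted from it. *)
Definition unit_ball_family x := if q x <= 1 then x else 0.

Lemma unit_ball_family_bounded : bounded_family unit_ball_family.
Proof. by exists 1 => x; rewrite /unit_ball_family; case: ifP => // _; rewrite qp0. Qed.

(** The argument of F. Riesz: if finitely many balls of radius [1 / 2] covered the
    unit ball, an almost nearest point of the span of their centers could be
    improved. *)
Lemma unit_ball_noncompact : ~ finite_dim [set: X] ->
  0 < noncompactness unit_ball_family.
Proof.
move=> ninf; rewrite ltNge; apply/negP => a0.
have half0 : 0 < 1 / 2 :> R by rewrite divr_gt0.
have [r [r0 [t Ht] rlt]] := noncompactness_approx unit_ball_family_bounded half0.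
have {a0}r2 : r < 1 / 2 by apply: lt_le_trans rlt _; rewrite gerDr.
have HS := span_seq_subspace t.
have [x tx] : exists x, ~ span_seq t x.
  apply/existsNP => H; apply: ninf.
  by apply: (@sub_span_finite_dim _ t) => [|x _]; first by split.
have d0 := sdist_gt0 tx; set d := sdist t x in d0.
have [_ [y ty <-] yd] : exists2 e, [set q (x - y) | y in span_seq t] e & e < d * 2.
  apply: inf_lt; first by case: (sdist_has_inf t x).
  by rewrite -/(sdist t x) -/d mulr2n mulrDr mulr1 ltrDl.
have z0 : 0 < q (x - y) by apply: lt_le_trans d0 _; exact: sdist_le.
have [s s0 hs] : exists2 s : R, 0 <= s & h (s%:C)%C = (q (x - y))^-1.
  by apply: cmodp_surj => //; rewrite invr_ge0 ltW.
set a := (s%:C)%C in hs.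
have a0 : a != 0.
  apply: contra_eq_neq hs => ->; rewrite cmodp0// eq_sym invr_eq0 gt_eqF//.
have qa : q (a *: (x - y)) = 1 by rewrite qpZ hs mulVf// gt_eqF.
have [z zt] := Ht (a *: (x - y)); rewrite /unit_ball_family qa lexx => az.
have : d <= q (x - (y + a^-1 *: z)).
  apply: sdist_le; apply: (subspaceD HS ty); exact: (subspaceZ _ HS (span_seq_mem zt)).
have -> : x - (y + a^-1 *: z) = a^-1 *: (a *: (x - y) - z).
  by rewrite scalerBr scalerA mulVf// scale1r opprD addrA.
rewrite qpZ cmodpV// hs invrK leNgt => /negP; apply.
apply: (@le_lt_trans _ _ (q (x - y) * r)); first by rewrite ler_wpM2l// ltW.
apply: (@lt_trans _ _ (q (x - y) * (1 / 2))); first by rewrite ltr_pM2l.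
by rewrite mul1r ltr_pdivrMr.
Qed.

(** * Polynomials in an operator *)

Section PolynomialAction.
Variable T : {linear X -> X}.

Definition poly_act (P : {poly C}) x := \sum_(i < size P) P`_i *: iter i T x.

Lemma poly_actE n (P : {poly C}) x : (size P <= n)%N ->
  poly_act P x = \sum_(i < n) P`_i *: iter i T x.
Proof.
move=> Pn; rewrite /poly_act (big_ord_widen n (fun i => P`_i *: iter i T x) Pn).
rewrite big_mkcond; apply: eq_bigr => i _; case: ltnP => // Pi.
by rewrite nth_default// scale0r.
Qed.

Lemma poly_actD (P Q : {poly C}) x : poly_act (P + Q) x = poly_act P x + poly_act Q x.
Proof.
pose n := maxn (size P) (size Q).
rewrite !(@poly_actE n) ?leq_maxl ?leq_maxr ?size_polyD// -big_split.
by apply: eq_bigr => i _; rewrite coefD scalerDl.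
Qed.

Lemma poly_actZ a (P : {poly C}) x : poly_act (a *: P) x = a *: poly_act P x.
Proof.
rewrite !(@poly_actE (size P)) ?size_scale_leq// scaler_sumr.
by apply: eq_bigr => i _; rewrite coefZ scalerA.
Qed.

Lemma poly_actX (P : {poly C}) x : poly_act ('X * P) x = T (poly_act P x).
Proof.
rewrite (@poly_actE (size P).+1); last first.
  by rewrite (leq_trans (size_polyMleq _ _))// size_polyX.
rewrite big_ord_recl coefXM scale0r add0r /poly_act linear_sum.
by apply: eq_bigr => i _; rewrite coefXM linearZ.
Qed.

Lemma poly_act1 x : poly_act 1 x = x.
Proof. by rewrite /poly_act size_poly1 big_ord1 coefC scale1r. Qed.

Lemma poly_act_bounded (M : R) (P : {poly C}) : 0 <= M ->
  (forall x, q (T x) <= M * q x) ->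
  exists2 K, 0 <= K & forall x, q (poly_act P x) <= K * q x.
Proof.
move=> M0 HM; rewrite /poly_act; elim: (size P) => [|n [K K0 HK]].
  by exists 0 => // x; rewrite big_ord0 qp0 mul0r.
have HT : forall x, q (iter n T x) <= M ^+ n * q x.
  elim: n {HK} => [|n IH] x; first by rewrite mul1r.
  rewrite iterS exprS -mulrA; apply: le_trans (HM _) _; exact: ler_wpM2l.
exists (K + h P`_n * M ^+ n); first by rewrite addr_ge0 ?mulr_ge0 ?cmodp_ge0 ?exprn_ge0.
move=> x; rewrite big_ord_recr /=; apply: le_trans (qpD _ _) _.
by rewrite mulrDl lerD// qpZ -mulrA ler_wpM2l// cmodp_ge0.
Qed.

(** The noncompactness of the image of the unit ball under [P(T)] is a p-seminorm
    in [P], to which [shifts_below_eq0] applies. *)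
Lemma essential_spectrum_nonempty (M : R) : ~ finite_dim [set: X] ->
  (forall x, q (T x) <= M * q x) ->
  ~ forall l : C, exists c, forall u : X -> X, bounded_family u ->
      noncompactness u <= c * noncompactness (fun i => T (u i) - l *: u i).
Proof.
move=> ninf HM Hl.
have HM' x : q (T x) <= (1 + `|M|) * q x.
  apply: le_trans (HM _) _; rewrite ler_wpM2r ?qp_ge0//.
  by rewrite (le_trans (ler_norm _))// lerDr.
have M0 : 0 < 1 + `|M| by rewrite ltr_pwDl.
pose act P i := poly_act P (unit_ball_family i).
have bact P : bounded_family (act P).
  have [K K0 HK] := poly_act_bounded P (ltW M0) HM'.
  exact: (bounded_family_op K0 HK unit_ball_family_bounded).
have := unit_ball_noncompact ninf.
have -> : unit_ball_family = act 1 by apply/funext => i; rewrite /act poly_act1.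
suff -> : noncompactness (act 1) = 0 by rewrite ltxx.
apply: (@shifts_below_eq0 R p p_gt0 (fun P => noncompactness (act P)) _ _ _ _ M0).
- by move=> P; exact: noncompactness_ge0.
- move=> P Q; have -> : act (P + Q) = fun i => act P i + act Q i.
    by apply/funext => i; exact: poly_actD.
  exact: noncompactnessD.
- move=> a P; have -> : act (a *: P) = fun i => *:%R a (act P i).
    by apply/funext => i; exact: poly_actZ.
  by apply: noncompactness_op => // [|x]; rewrite ?cmodp_ge0 ?qpZ.
- move=> P; have -> : act ('X * P) = fun i => T (act P i).
    by apply/funext => i; exact: poly_actX.
  exact: noncompactness_op (ltW M0) HM' _.
- move=> l; have [c Hc] := Hl l; exists c => P.
  suff -> : act (('X - l%:P) * P) = fun i => T (act P i) - l *: act P i by exact: Hc.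
  apply/funext => i; rewrite mulrBl mul_polyC -scaleNr /act poly_actD poly_actX.
  by rewrite poly_actZ scaleNr.
Qed.

End PolynomialAction.

(** * Operators that are not small on any infinite-dimensional subspace *)

Section Operator.
Variables (S : {linear X -> X}) (M : R).
Hypotheses (M_ge0 : 0 <= M) (HM : forall x, q (S x) <= M * q x).

(** The largest p-seminorm below [q] and [k * q (S x)].  It is continuous for the
    topology induced by [S], unlike [q], and as [k] grows it increases to the
    gauge of the closure of the unit ball in that topology. *)
Definition gauge (k : R) x := inf [set q u + k * q (S (x - u)) | u in [set: X]].

Lemma gauge_ge (k d : R) x :
  (forall u, d <= q u + k * q (S (x - u))) -> d <= gauge k x.
Proof.
by move=> H; apply: lb_le_inf => [|_ [u _ <-]//]; exists (q 0 + k * q (S (x - 0))), 0.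
Qed.

Lemma gauge_le (k : R) x u : 0 <= k -> gauge k x <= q u + k * q (S (x - u)).
Proof.
move=> k0; apply: ge_inf; last by exists u.
by exists 0 => _ [v _ <-]; rewrite addr_ge0 ?mulr_ge0 ?qp_ge0.
Qed.

Lemma gauge_le_q (k : R) x : 0 <= k -> gauge k x <= q x.
Proof. by move=> /(gauge_le x x); rewrite subrr linear0 qp0 mulr0 addr0. Qed.

Lemma gauge_le_S (k : R) x : 0 <= k -> gauge k x <= k * q (S x).
Proof. by move=> /(gauge_le x 0); rewrite subr0 qp0 add0r. Qed.

Lemma gaugeD (k : R) x y : 0 <= k -> gauge k (x + y) <= gauge k x + gauge k y.
Proof.
move=> k0; rewrite -lerBlDr; apply: gauge_ge => u; rewrite lerBlDr -lerBlDl.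
apply: gauge_ge => v; rewrite lerBlDl.
apply: le_trans (gauge_le _ (u + v) k0) _.
have -> : x + y - (u + v) = (x - u) + (y - v) by rewrite opprD addrACA.
rewrite [leRHS]addrACA; apply: lerD; first exact: qpD.
by rewrite -mulrDr ler_wpM2l// linearD; exact: qpD.
Qed.

Lemma gauge_mono (k l : R) x : 0 <= k -> k <= l -> gauge k x <= gauge l x.
Proof.
move=> k0 kl; apply: gauge_ge => u; apply: le_trans (gauge_le _ u k0) _.
by rewrite lerD2l ler_wpM2r// qp_ge0.
Qed.

Lemma gaugeZ_le (k : R) a x : 0 <= k -> h a * gauge k x <= gauge k (a *: x).
Proof.
move=> k0; have [->|a0] := eqVneq a 0.
  rewrite cmodp0// mul0r; apply: gauge_ge => u.
  by rewrite addr_ge0 ?mulr_ge0 ?qp_ge0.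
apply: gauge_ge => u; have -> : u = a *: (a^-1 *: u) by rewrite scalerA divff// scale1r.
rewrite -scalerBr [S _]linearZ !(qpZ a) [k * (h a * _)]mulrCA -mulrDr ler_wpM2l ?cmodp_ge0//.
exact: gauge_le.
Qed.

(** The invariant of the construction of a subspace on which [S] is small.  The
    strict inequality [kap < eta] leaves room for further steps.  The constant
    [K] stands in for the compactness of the unit sphere of [W], and it comes
    with the construction. *)
Definition small_on (eta : R) W := exists k kap K : R,
  [/\ 0 <= k, 0 < kap, kap < eta, 0 < K &
   forall w, W w -> q (S w) <= kap * gauge k w /\ q w <= K * q (S w)].

(** The arithmetic of [small_on_extend], where [w] belongs to the given subspace
    and [x] is the vector to be added.  The numbers [s], [qx], [G0] stand for
    [q (S x)], [q x], [gauge k' x]; [t], [qw], [gk] for [q (S w)], [q w],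
    [gauge k w]; and [u], [v], [G] for [q (S (w + x))], [q (w + x)],
    [gauge k' (w + x)].  The number [B * s] separates the regime in which [x]
    perturbs [w] from the one in which [w] perturbs [x]. *)
Lemma perturbation_bounds (kap kap' k k' K B s qx G0 t qw gk u v G : R) :
  0 < kap -> 0 < kap' -> 0 <= k -> 0 <= k' -> 0 < K -> 2 <= B ->
  1 + kap' * k <= (kap' / kap - 1) * B -> 0 < s -> 0 <= qx ->
  (K * B + (B + 1) / kap' + 1 + K) * s < G0 ->
  t <= kap * gk -> qw <= K * t -> 0 <= u -> u <= t + s -> t - s <= u ->
  v <= qw + qx -> gk <= G + k * s -> G0 <= G + qw -> G <= k' * u ->
  u <= kap' * G /\ v <= (2 * (K + qx / s) + (K * B + qx / s) * k') * u.
Proof.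
move=> kap0 kap'0 k0 k'0 K0 B2 HB s0 qx0 Hx w1 w2 u0 Sup low qup ga gb Gk'.
have qxs0 : 0 <= qx / s by rewrite divr_ge0// ltW.
have KB0 : 0 <= K * B by rewrite mulr_ge0 ?(ltW K0)//; lra.
have Bk0 : 0 <= (B + 1) / kap' by rewrite divr_ge0 ?(ltW kap'0)//; lra.
have [tB|tB] := leP (B * s) t.
  have rat0 : 0 <= kap' / kap - 1.
    have kk : 0 <= kap' * k by rewrite mulr_ge0// ltW.
    rewrite leNgt; apply/negP => r0; have : (kap' / kap - 1) * B <= 0.
      by rewrite mulr_le0_ge0 ?(ltW r0)//; lra.
    lra.
  have g2 : t / kap <= gk by rewrite ler_pdivrMr// mulrC.
  have g3 : (1 + kap' * k) * s <= (kap' / kap - 1) * t.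
    apply: (@le_trans _ _ ((kap' / kap - 1) * (B * s))); last by rewrite ler_wpM2l.
    by rewrite mulrA ler_wpM2r// ltW.
  have g4 : kap' * (t / kap) <= kap' * (G + k * s).
    by rewrite ler_wpM2l ?(ltW kap'0)// (le_trans g2).
  split; first by move: g3 g4; rewrite mulrDr mulrA ![_ * (k * s)]mulrA; lra.
  have g6 : qx <= qx / s * t.
    rewrite -[qx in leLHS](divfK (lt0r_neq0 s0)) ler_wpM2l//.
    by apply: le_trans tB; rewrite ler_peMl ?(ltW s0)//; lra.
  have g7 : 2 * s <= t by apply: le_trans tB; rewrite ler_wpM2r// ltW.
  have g8 : 0 <= (K * B + qx / s) * k' by rewrite mulr_ge0// addr_ge0.
  apply: (@le_trans _ _ ((K + qx / s) * t)); first by rewrite mulrDl; lra.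
  apply: (@le_trans _ _ ((K + qx / s) * (2 * u))).
    by rewrite ler_wpM2l ?addr_ge0 ?(ltW K0)//; lra.
  by rewrite mulrCA mulrA ler_wpM2r// lerDl.
have g0 : qw <= K * B * s.
  by apply: le_trans w2 _; rewrite -mulrA ler_wpM2l ?(ltW K0)// ltW.
have g2 : ((B + 1) / kap' + 1) * s <= G.
  have Ks : 0 <= K * s by rewrite mulr_ge0 ?ltW.
  by move: Hx; rewrite !mulrDl; lra.
split.
  apply: (@le_trans _ _ ((B + 1) * s)); first by rewrite mulrDl; lra.
  apply: (@le_trans _ _ (kap' * (((B + 1) / kap' + 1) * s))); last first.
    by rewrite ler_wpM2l// ltW.
  rewrite mulrA ler_wpM2r ?(ltW s0)// mulrDr mulrCA divff ?gt_eqF// !mulr1.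
  by rewrite lerDl ltW.
have g3 : s <= k' * u.
  apply: le_trans Gk'; apply: le_trans g2.
  by rewrite mulrDl mul1r lerDr mulr_ge0// ltW.
apply: (@le_trans _ _ ((K * B + qx / s) * s)).
  by rewrite mulrDl divfK ?gt_eqF//; lra.
apply: (@le_trans _ _ ((K * B + qx / s) * (k' * u))).
  by rewrite ler_wpM2l// addr_ge0.
rewrite mulrA ler_wpM2r// lerDr mulr_ge0// addr_ge0//; exact: ltW.
Qed.

(** If [x] has small image relative to its gauge, consider [w + x] with [w] in
    [W].  When [S w] is large compared with [S x], the vector [x] is a
    perturbation of [w] for [S] and for [gauge k], and the estimates for [w]
    survive with a slightly larger [kap].  Otherwise [w] itself is small, because
    [q w <= K * q (S w)], and [w + x] behaves like [x]. *)
Lemma small_on_extend (eta : R) W : is_subspace W -> small_on eta W ->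
  (forall D : R, exists k x, 0 <= k /\ D * q (S x) < gauge k x) ->
  exists W', [/\ is_subspace W', small_on eta W', W `<=` W' & exists2 x, W' x & ~ W x].
Proof.
move=> HW [k [kap [K [k0 kap0 kape K0 HK]]]] HD.
have [kap' kk' kap'e] : exists2 kap' : R, kap < kap' & kap' < eta.
  by exists ((kap + eta) / 2); lra.
have kap'0 : 0 < kap' := lt_trans kap0 kk'.
have rat0 : 0 < kap' / kap - 1 by rewrite subr_gt0 ltr_pdivlMr// mul1r.
have [B B2 HB] : exists2 B : R, 2 <= B & 1 + kap' * k <= (kap' / kap - 1) * B.
  have k10 : 0 <= 1 + kap' * k by rewrite addr_ge0// mulr_ge0// ltW.
  exists ((1 + kap' * k) / (kap' / kap - 1) + 2); first by rewrite lerDr divr_ge0// ltW.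
  by rewrite mulrDr [_ * (_ / _)]mulrC divfK ?gt_eqF// lerDl mulr_ge0// ltW.
have [k1 [x [k10 Hx]]] := HD (K * B + (B + 1) / kap' + 1 + K).
set s := q (S x) in Hx.
have KB0 : 0 <= K * B by rewrite mulr_ge0 ?(ltW K0)//; lra.
have Bk0 : 0 <= (B + 1) / kap' by rewrite divr_ge0 ?(ltW kap'0)//; lra.
have s0 : 0 < s.
  rewrite lt_neqAle qp_ge0 andbT; apply/eqP => s0; move: Hx; rewrite -s0 mulr0.
  by move=> /lt_le_trans/(_ (gauge_le_S x k10)); rewrite -/s -s0 mulr0 ltxx.
pose k' := Num.max k k1.
have k'0 : 0 <= k' by rewrite le_max k0.
have kk1 : k <= k' by rewrite le_max lexx.
have {}Hx : (K * B + (B + 1) / kap' + 1 + K) * s < gauge k' x.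
  by apply: lt_le_trans Hx _; apply: gauge_mono => //; rewrite le_max lexx orbT.
have xW : ~ W x.
  move=> Wx; have [_ xK] := HK x Wx.
  have := lt_le_trans Hx (le_trans (gauge_le_q x k'0) xK); rewrite -/s ltr_pM2r//.
  by apply/negP; rewrite -leNgt; lra.
pose K' := 2 * (K + q x / s) + (K * B + q x / s) * k'.
have qxs0 : 0 <= q x / s by rewrite divr_ge0 ?qp_ge0// ltW.
have K'0 : 0 < K'.
  by rewrite ltr_pwDl ?mulr_gt0 ?ltr_pwDl// mulr_ge0// addr_ge0.
have key w : W w -> q (S (w + x)) <= kap' * gauge k' (w + x) /\
                    q (w + x) <= K' * q (S (w + x)).
  move=> Ww; have [w1 w2] := HK w Ww.
  apply: (perturbation_bounds kap0 kap'0 k0 k'0 K0 B2 HB s0 (qp_ge0 x) Hx w1 w2).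
  - exact: qp_ge0.
  - by rewrite linearD; exact: qpD.
  - by rewrite lerBlDr; have := qpB (S (w + x)) (S x); rewrite -linearB addrK.
  - exact: qpD.
  - rewrite -[w in leLHS](addrK x); apply: le_trans (gaugeD _ _ k0) _.
    apply: lerD; first exact: gauge_mono.
    by apply: le_trans (gauge_le_S _ k0) _; rewrite linearN qpN.
  - rewrite -[x in leLHS](addKr w) addrC; apply: le_trans (gaugeD _ _ k'0) _.
    by apply: lerD => //; rewrite -(qpN w); exact: gauge_le_q.
  - exact: gauge_le_S.
exists [set v | exists a, W (v - a *: x)]; split.
- split; first by exists 0; rewrite scale0r subr0; exact: subspace0.
  move=> a u v [c uc] [d vd]; exists (a * c + d).
  have -> : a *: u + v - (a * c + d) *: x = a *: (u - c *: x) + (v - d *: x).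
    by rewrite scalerBr scalerDl scalerA opprD addrACA.
  by apply: subspaceD => //; exact: subspaceZ.
- exists k', kap', K'; split=> // v [a va].
  have [a0|a0] := eqVneq a 0.
    rewrite a0 scale0r subr0 in va; have [v1 v2] := HK v va; split.
      apply: le_trans v1 _; apply: ler_pM; [exact: ltW| |exact: ltW|exact: gauge_mono].
      by apply: gauge_ge => u; rewrite addr_ge0 ?mulr_ge0 ?qp_ge0.
    apply: le_trans v2 _; rewrite ler_wpM2r ?qp_ge0// /K'.
    have g8 : 0 <= (K * B + q x / s) * k' by rewrite mulr_ge0// addr_ge0.
    by lra.
  have -> : v = a *: (a^-1 *: (v - a *: x) + x).
    by rewrite scalerDr scalerA divff// scale1r subrK.
  have [h1 h2] := key _ (subspaceZ a^-1 HW va).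
  rewrite [S _]linearZ !qpZ; split.
    apply: (@le_trans _ _ (kap' * (h a * gauge k' (a^-1 *: (v - a *: x) + x)))).
      by rewrite mulrCA ler_wpM2l ?cmodp_ge0.
    by rewrite ler_wpM2l ?(ltW kap'0)//; exact: gaugeZ_le.
  by rewrite mulrCA ler_wpM2l ?cmodp_ge0.
- by move=> w Ww; exists 0; rewrite scale0r subr0.
- by exists x => //; exists 1; rewrite scale1r subrr; exact: subspace0.
Qed.

(** The union of the spaces obtained by iterating [small_on_extend] from the zero
    space is not finite-dimensional: generators would all lie in one stage,
    which is strictly contained in the next. *)
Lemma small_subspace (eta : R) : 0 < eta ->
  (forall D : R, exists k x, 0 <= k /\ D * q (S x) < gauge k x) ->
  exists2 W, infinite_dim_subspace W & forall w, W w -> q (S w) <= eta * q w.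
Proof.
move=> eta0 HD; pose stage := {W : set X | is_subspace W /\ small_on eta W}.
have [next Hnext] : {next : stage -> stage & forall W : stage,
    sval W `<=` sval (next W) /\ exists2 x, sval (next W) x & ~ sval W x}.
  apply: (@choice _ _ (fun W W' : stage => sval W `<=` sval W' /\
    exists2 x, sval W' x & ~ sval W x)) => -[W [HW sW]].
  have [W' [HW' sW' WW' Wx]] := small_on_extend HW sW HD.
  by exists (exist _ W' (conj HW' sW')).
have stage0 : is_subspace [set (0 : X)] /\ small_on eta [set (0 : X)].
  split; first by split=> // a x y -> ->; rewrite scaler0 addr0.
  exists 0, (eta / 2), 1; split=> //; [lra|lra|] => w ->.
  rewrite linear0 qp0 mulr0; split=> //; apply: mulr_ge0; first lra.
  by apply: gauge_ge => u; rewrite mul0r addr0 qp_ge0.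
pose Wn n := sval (iter n next (exist _ [set 0] stage0)).
have Wsub n : is_subspace (Wn n) by rewrite /Wn; case: (iter n next _) => ? [].
have Wmono m n : (m <= n)%N -> Wn m `<=` Wn n.
  elim: n => [|n IH]; first by rewrite leqn0 => /eqP ->.
  rewrite leq_eqVlt => /predU1P[-> //|/IH mn]; apply: subset_trans mn _.
  by have [] := Hnext (iter n next (exist _ [set 0] stage0)).
pose W := \bigcup_n Wn n.
exists W; last first.
  move=> w [n _]; rewrite /Wn.
  case: (iter n next _) => V [_ [k [kap [K [k0 kap0 kape _ HK]]]]] /= Vw.
  have [h1 _] := HK w Vw; apply: le_trans h1 _.
  apply: ler_pM; rewrite ?(ltW kap0) ?(ltW kape) ?gauge_le_q//.
  by apply: gauge_ge => u; rewrite addr_ge0 ?mulr_ge0 ?qp_ge0.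
split.
  split; first by exists 0%N.
  move=> a x y [m _ xm] [n _ yn]; exists (maxn m n) => //.
  apply: subspaceD => //; first by apply: subspaceZ => //; apply: Wmono xm; exact: leq_maxl.
  by apply: Wmono yn; exact: leq_maxr.
move=> /finite_dim_span[s sW Ws].
have [n Hn] : exists n, forall b, b \in s -> Wn n b.
  elim: s sW {Ws} => [|b s IH] sW; first by exists 0%N.
  have [n Hn] : exists n, forall b, b \in s -> Wn n b.
    by apply: IH => x xs; apply: sW; rewrite inE xs orbT.
  have [m _ bm] := sW b (mem_head _ _).
  exists (maxn m n) => x; rewrite inE => /predU1P[->|/Hn xn].
    by apply: Wmono bm; exact: leq_maxl.
  by apply: Wmono xn; exact: leq_maxr.
have [_ [x xn1 xn]] := Hnext (iter n next (exist _ [set 0] stage0)).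
by apply: xn; apply: (span_seq_sub (Wsub n) Hn); apply: Ws; exists n.+1.
Qed.

(** The open mapping argument: when the gauges are dominated by [q \o S], every
    [S x] can be hit, up to half its size, by a vector of comparable size, and
    by completeness the successive corrections converge to [x] modulo the
    kernel of [S]. *)
Lemma bounded_below_mod_kernel (D : R) :
  (forall k x, 0 <= k -> gauge k x <= D * q (S x)) ->
  exists2 c, 0 <= c & forall x, exists2 y, S y = 0 & q (x - y) <= c * q (S x).
Proof.
move=> HD; pose E := 1 + `|D|.
have E0 : 0 < E by rewrite ltr_pwDl.
have HE k x : 0 <= k -> gauge k x <= E * q (S x).
  move=> k0; apply: le_trans (HD _ _ k0) _; rewrite ler_wpM2r ?qp_ge0//.
  by rewrite (le_trans (ler_norm _))// lerDr.
have [g Hg] : {g : X -> X & forall x, q (g x) <= 2 * E * q (S x) /\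
    q (S (x - g x)) <= q (S x) / 2}.
  apply: (@choice _ _ (fun x u => q u <= 2 * E * q (S x) /\
    q (S (x - u)) <= q (S x) / 2)) => x.
  have [Sx0|Sx0] := eqVneq (q (S x)) 0.
    by exists 0; rewrite subr0 Sx0 qp0 mulr0 mul0r.
  have Sx : 0 < q (S x) by rewrite lt_neqAle eq_sym Sx0 qp_ge0.
  (* the factor [4 * E] makes the second summand of an almost optimal
     decomposition at most half of [q (S x)] *)
  have [_ [u _ <-] Hu] : exists2 r, [set q u + 4 * E * q (S (x - u)) | u in [set: X]] r
      & r < 2 * E * q (S x).
    apply: inf_lt; first by exists (q 0 + 4 * E * q (S (x - 0))), 0.
    apply: le_lt_trans (HE _ _ _) _; first by rewrite mulr_ge0// ltW.
    by rewrite -mulrA ltr_pMl ?mulr_gt0// ltr1n.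
  exists u; have u1 := qp_ge0 u; have u2 := qp_ge0 (S (x - u)); split.
    by apply: le_trans (ltW Hu); rewrite lerDl !mulr_ge0 ?(ltW E0).
  rewrite -(ler_pM2l E0); move: Hu; lra.
exists (2 * (2 * E)) => [|x]; first by rewrite !mulr_ge0// ltW.
pose r n := iter n (fun z => z - g z) x.
have Sr n : q (S (r n)) <= q (S x) / 2 ^+ n.
  elim: n => [|n IH]; first by rewrite expr0 divr1.
  have [_ H] := Hg (r n); apply: le_trans H _.
  by rewrite exprSr invfM mulrA ler_pM2r ?invr_gt0.
have [l Hl] : exists l, forall n, q (l - r n) <= 2 * (2 * E * q (S x)) / 2 ^+ n.
  apply: qp_complete => n; have [H _] := Hg (r n).
  rewrite [r n.+1]/r iterS -/(r n).
  have -> : r n - g (r n) - r n = - g (r n) by rewrite addrAC subrr add0r.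
  rewrite qpN; apply: le_trans H _; rewrite -[leRHS]mulrA ler_wpM2l//.
  by rewrite !mulr_ge0// ltW.
exists l; last by rewrite qpC; have := Hl 0%N; rewrite expr0 divr1 !mulrA.
apply: qp_eq0; apply/eqP; rewrite eq_le qp_ge0 andbT.
apply/ler_addgt0Pr => e e0; rewrite add0r.
(* [l] is a limit of vectors whose images under [S] tend to zero *)
have [k Hk] := geom_small (M * (2 * (2 * E * q (S x))) + q (S x)) e0.
have := Hk k (leqnn k); rewrite mulrDl => /ltW; apply: le_trans.
rewrite -[l in leLHS](subrK (r k)) linearD; apply: le_trans (qpD _ _) _.
rewrite lerD//; apply: le_trans (HM _) _; rewrite -[leRHS]mulrA ler_wpM2l//.
Qed.

Lemma bounded_below_of_not_small (eta : R) : 0 < eta ->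
  (forall W, infinite_dim_subspace W -> ~ forall w, W w -> q (S w) <= eta * q w) ->
  finite_dim [set x | S x = 0] /\
  exists2 c, 0 <= c & forall x, exists2 y, S y = 0 & q (x - y) <= c * q (S x).
Proof.
move=> eta0 Hsmall; split.
  apply: contrapT => Hinf; apply: (Hsmall [set x | S x = 0]).
    split=> //; split; first exact: linear0.
    by move=> a x y /= Sx Sy; rewrite linearP Sx Sy scaler0 addr0.
  by move=> w /= ->; rewrite qp0 mulr_ge0 ?qp_ge0// ltW.
apply: contrapT => Hbelow.
have [|W Winf HW] := small_subspace eta0; last exact: Hsmall Winf HW.
move=> D; apply: contrapT => HD; apply: Hbelow; apply: (@bounded_below_mod_kernel D).
move=> k x k0; rewrite leNgt; apply/negP => HkD.
by apply: HD; exists k, x.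
Qed.

End Operator.

(** * Hereditary indecomposability *)

Section Indecomposable.
Variables (S : {linear X -> X}) (M : R).
Hypotheses (M_ge0 : 0 <= M) (HM : forall x, q (S x) <= M * q x).

Definition qclosure V : set X :=
  [set x | forall e : R, 0 < e -> exists2 y, V y & q (x - y) < e].

Lemma sub_qclosure V : V `<=` qclosure V.
Proof. by move=> x Vx e e0; exists x; rewrite // subrr qp0. Qed.

Lemma qclosureK V x :
  (forall e, 0 < e -> exists2 y, qclosure V y & q (x - y) < e) -> qclosure V x.
Proof.
move=> H e e0; have e2 : 0 < e / 2 by rewrite divr_gt0.
have [y /(_ _ e2)[z Vz yz] xy] := H _ e2.
by exists z => //; apply: le_lt_trans (qp_tri y _ _) _; rewrite [e]splitr ltrD.
Qed.

Lemma qclosure_closed V : closed (qclosure V).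
Proof. by apply: qp_closed => x; exact: qclosureK. Qed.

Lemma qclosure_subspace V : is_subspace V -> is_subspace (qclosure V).
Proof.
move=> HV; split; first exact: (sub_qclosure (subspace0 HV)).
move=> a x y Vx Vy e e0; have h1 : 0 < 1 + h a by rewrite ltr_pwDl ?cmodp_ge0.
have d0 := divr_gt0 e0 h1.
have [x' Vx' xx'] := Vx _ d0; have [y' Vy' yy'] := Vy _ d0.
exists (a *: x' + y'); first by apply: subspaceD => //; exact: subspaceZ.
rewrite opprD addrACA -scalerBr; apply: le_lt_trans (qpD _ _) _.
rewrite qpZ [ltLHS]addrC; set d := e / _ in d0 xx' yy'.
have -> : e = d + h a * d by rewrite -[d in X in X + _]mul1r -mulrDl /d mulrC divfK// gt_eqF.
by apply: ltr_leD => //; rewrite ler_wpM2l ?cmodp_ge0// ltW.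
Qed.

Lemma qclosure_infinite V : infinite_dim_subspace V ->
  infinite_dim_subspace (qclosure V).
Proof.
move=> [HV Vinf]; split; first exact: qclosure_subspace.
by move=> cVfin; apply: Vinf; apply: sub_finite_dim cVfin => //; exact: sub_qclosure.
Qed.

Lemma qp_dist_le x y : `|q x - q y| <= q (x - y).
Proof.
rewrite ler_norml lerNl opprB !lerBlDr; apply/andP; split.
  by rewrite qpC -{1}(subrK x y); exact: qpD.
by rewrite -{1}(subrK y x); exact: qpD.
Qed.

(** The coefficients may be negative, so that this covers upper bounds for
    [q \o S] as well as lower ones. *)
Lemma qclosure_le V (a b : R) :
  (forall x, V x -> a * q x <= b * q (S x)) ->
  forall x, qclosure V x -> a * q x <= b * q (S x).
Proof.
move=> H x Vx; apply/ler_addgt0Pr => e e0.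
have d1 : 0 < 1 + (`|a| + `|b| * M) by rewrite ltr_pwDl// addr_ge0// mulr_ge0.
have [y Vy xy] := Vx _ (divr_gt0 e0 d1); have Hy := H y Vy.
have bound (k s t d : R) : `|s - t| <= d -> k * s - k * t <= `|k| * d.
  move=> std; rewrite -mulrBr; apply: le_trans (ler_norm _) _.
  by rewrite normrM ler_wpM2l.
have h1 := bound a _ _ _ (qp_dist_le x y).
have h2 : b * q (S y) - b * q (S x) <= `|b| * (M * q (x - y)).
  apply: bound; apply: le_trans (qp_dist_le _ _) _.
  by rewrite -linearB qpC -qpN -linearN opprB; apply: le_trans (HM _) _; rewrite // qpC.
have h3 : (`|a| + `|b| * M) * q (x - y) <= e.
  move: xy; rewrite ltr_pdivlMr// => /ltW; apply: le_trans.
  by rewrite mulrC ler_wpM2l ?qp_ge0// lerDr.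
by move: h3; rewrite mulrDl -mulrA; lra.
Qed.

(** Otherwise [S] would separate the unit spheres of [V] and [W], and the two
    closures would form a topological direct sum. *)
Lemma embedding_not_small (c : R) V : hereditarily_indecomposable X ->
  0 < c -> infinite_dim_subspace V -> (forall v, V v -> c * q v <= q (S v)) ->
  forall W, infinite_dim_subspace W -> ~ forall w, W w -> q (S w) <= c / 2 * q w.
Proof.
move=> HI c0 Vinf HV W Winf HW; apply: HI.
have cV v : qclosure V v -> c * q v <= q (S v).
  move=> Vv; rewrite -[leRHS]mul1r; apply: qclosure_le Vv => x /HV.
  by rewrite mul1r.
have cW w : qclosure W w -> q (S w) <= c / 2 * q w.
  move=> Ww; have H : - (c / 2) * q w <= -1 * q (S w).
    by apply: qclosure_le Ww => x /HW; rewrite !mulNr mul1r lerN2.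
  by move: H; rewrite !mulNr mul1r lerN2.
have [V0 VS] := qclosure_subspace (proj1 Vinf).
have [W0 WS] := qclosure_subspace (proj1 Winf).
(* the positive angle between the two closures *)
have angle v w : qclosure V v -> qclosure W w ->
    q v <= 2 / c * (M + c / 2) * q (v + w).
  move=> /cV Vv /cW Ww.
  have h1 : q (S v) <= M * q (v + w) + q (S w).
    have -> : S v = S (v + w) - S w by rewrite linearD addrK.
    by apply: le_trans (qpB _ _) _; rewrite lerD2r.
  have h2 : q w <= q (v + w) + q v.
    have -> : q w = q (v + w - v) by rewrite addrAC subrr add0r.
    exact: qpB.
  have h3 : c / 2 * q w <= c / 2 * (q (v + w) + q v) by rewrite ler_wpM2l// divr_ge0// ltW.
  have h4 : c / 2 * q v <= (M + c / 2) * q (v + w).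
    by rewrite mulrDl; move: h1 h3; rewrite mulrDr; lra.
  have c2 : 0 < c / 2 by rewrite divr_gt0.
  rewrite -(ler_pM2l c2); apply: le_trans h4 _; rewrite le_eqVlt; apply/orP; left; apply/eqP.
  by field; exact: lt0r_neq0.
exists (qclosure V), (qclosure W); split.
- by split; [exact: qclosure_infinite|exact: qclosure_closed].
- by split; [exact: qclosure_infinite|exact: qclosure_closed].
- apply/seteqP; split=> [x [Vx Wx]|x ->]; last by split.
  apply/qp_eq0/eqP; rewrite eq_le qp_ge0 andbT.
  have := angle x (- x) Vx; rewrite subrr qp0 mulr0; apply.
  by rewrite -scaleN1r -[_ *: _]addr0; exact: WS.
apply: qp_closed => z Hz; set L := 2 / c * (M + c / 2) in angle.
have L0 : 0 <= L by rewrite mulr_ge0 ?addr_ge0 ?divr_ge0 ?(ltW c0).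
have [vw Hvw] : {vw : nat -> X * X & forall n, [/\ qclosure V (vw n).1,
    qclosure W (vw n).2 & q (z - ((vw n).1 + (vw n).2)) < 1 / 2 ^+ n]}.
  apply: (@choice _ _ (fun n (vw : X * X) => [/\ qclosure V vw.1,
    qclosure W vw.2 & q (z - (vw.1 + vw.2)) < 1 / 2 ^+ n])) => n.
  have n0 : 0 < 1 / 2 ^+ n :> R by rewrite divr_gt0// exprn_gt0.
  have [_ [v Vv [w Ww <-]] zvw] := Hz _ n0.
  by exists (v, w).
pose v n := (vw n).1; pose w n := (vw n).2.
have Vv n : qclosure V (v n) by case: (Hvw n).
have Ww n : qclosure W (w n) by case: (Hvw n).
have zn n : q (z - (v n + w n)) <= 1 / 2 ^+ n by apply/ltW; case: (Hvw n).
have [l Hl] : exists l, forall n, q (l - v n) <= 2 * (L * 2) / 2 ^+ n.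
  apply: qp_complete => n.
  apply: le_trans (angle _ (w n.+1 - w n) _ _) _.
  - by rewrite addrC -scaleN1r; exact: VS.
  - by rewrite addrC -scaleN1r; exact: WS.
  rewrite -/L -[leRHS]mulrA ler_wpM2l// addrACA -opprD.
  apply: le_trans (qp_tri z _ _) _; rewrite qpC.
  apply: le_trans (lerD (zn _) (zn _)) _.
  have p0 : 0 < 2 ^+ n :> R by rewrite exprn_gt0.
  rewrite exprS !div1r; have : 0 < (2 ^+ n)^-1 :> R by rewrite invr_gt0.
  rewrite invfM; lra.
have [K [K0 HK]] : exists K : R, 0 <= K /\ forall n, q (l - v n) <= K / 2 ^+ n.
  by exists (2 * (L * 2)); split=> //; exact: mulr_ge0 (ler0n _ 2) (mulr_ge0 L0 (ler0n _ 2)).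
exists l; first last.
  exists (z - l); last by rewrite addrC subrK.
  apply: qclosureK => e e0; have [k Hk] := geom_small (1 + K) e0.
  exists (w k) => //; apply: le_lt_trans (Hk k (leqnn _)).
  have -> : z - l - w k = z - (v k + w k) - (l - v k).
    rewrite opprB opprD [- v k - w k]addrC [z + (_ - v k)]addrA [RHS]addrA subrK.
    by rewrite addrAC.
  by apply: le_trans (qpB _ _) _; rewrite mulrDl lerD.
apply: qclosureK => e e0; have [k Hk] := geom_small K e0.
by exists (v k) => //; apply: le_lt_trans (HK k) (Hk k _).
Qed.

End Indecomposable.

Lemma bounded_operator_qp (S : X -> X) :
  bounded_operator S <-> exists2 K, 0 <= K & forall x, q (S x) <= K * q x.
Proof.
split=> [[K HK]|[K K0 HK]].
  exists (`|K| `^ p) => [|x]; first exact: powR_ge0.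
  rewrite -powRM ?qnorm_ge0//; apply: ge0_ler_powR.
  - exact: ltW.
  - by rewrite nnegrE qnorm_ge0.
  - by rewrite nnegrE mulr_ge0 ?qnorm_ge0.
  by apply: le_trans (HK x) _; rewrite ler_wpM2r ?qnorm_ge0// ler_norm.
exists (K `^ p^-1) => x; rewrite leNgt; apply/negP => lt.
have := HK x; rewrite leNgt => /negP; apply.
rewrite /q -[K in ltLHS](powRr1 K0) -(mulVf (lt0r_neq0 p_gt0)) powRrM.
rewrite -powRM ?powR_ge0 ?qnorm_ge0//.
by apply: gt0_ltr_powR; rewrite ?nnegrE ?mulr_ge0 ?powR_ge0 ?qnorm_ge0.
Qed.

Lemma embedding_qp V (S : X -> X) : isomorphic_embedding_on V S ->
  exists2 c, 0 < c & forall x, V x -> c * q x <= q (S x).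
Proof.
move=> [c [c0 Hc]]; exists (c `^ p) => [|x Vx]; first exact: powR_gt0.
rewrite -powRM ?qnorm_ge0 ?(ltW c0)//; apply: ge0_ler_powR.
- exact: ltW.
- by rewrite nnegrE mulr_ge0 ?qnorm_ge0// ltW.
- by rewrite nnegrE qnorm_ge0.
- exact: Hc.
Qed.

End PNorm.

Definition translate (K : comNzRingType) (X : lmodType K) (T : {linear X -> X}) (l : K)
  : {linear X -> X} := T \- l \*: idfun.

Unset Implicit Arguments.

Theorem theorem6p12 (R : realType) (X : quasiBanachType R) (p : R)
    (hp0 : 0 < p) (hp1 : p <= 1) (hsub : p_subadditive X p)
    (hinf : infinite_dim_subspace [set: X])
    (hHI : hereditarily_indecomposable X)
    (T : {linear X -> X}) (hT : bounded_operator T) :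
  exists (lambda : R[i]) (S : {linear X -> X}),
    [/\ bounded_operator S, strictly_singular S &
        forall x : X, T x = lambda *: x + S x].
Proof.
have [M M0 HM] := (bounded_operator_qp hp0 T).1 hT.
have HS l x : qp p (translate T l x) <= (M + cmodp p l) * qp p x.
  by rewrite mulrDl -(qpZ p); apply: le_trans (qpB hsub _ _) _; rewrite lerD2r.
have K0 l : 0 <= M + cmodp p l by rewrite addr_ge0 ?cmodp_ge0.
apply: contrapT => Hno.
have Hemb l : exists V c, [/\ infinite_dim_subspace V, 0 < c &
    forall v, V v -> c * qp p v <= qp p (translate T l v)].
  apply: contrapT => Hl; apply: Hno; exists l, (translate T l); split.
  - by apply/(bounded_operator_qp hp0); exists (M + cmodp p l).
  - by move=> V Vinf /(embedding_qp hp0)[c c0 Hc]; apply: Hl; exists V, c.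
  - by move=> x; rewrite addrC subrK.
apply: (essential_spectrum_nonempty hp0 hsub hinf.2 HM) => l.
have [V [c [Vinf c0 HV]]] := Hemb l.
have c2 : 0 < c / 2 by rewrite divr_gt0.
have Hsmall := embedding_not_small hp0 hsub (K0 l) (HS l) hHI c0 Vinf HV.
have [kerfin [d d0 Hd]] := bounded_below_of_not_small hp0 hsub (K0 l) (HS l) c2 Hsmall.
exists (2 * d) => u bu.
exact: (noncompactness_below hp0 hsub (K0 l) (HS l) d0 Hd kerfin bu).
Qed.
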